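(* Let $n\geq3$ and let $\xi\in\mathfrak{so}(n)$. Then $\xi$ is canonical, i.e. is the canonical element of some parabolic subalgebra of $\mathfrak{so}(n)^{\mathbb{C}}$, if and only if either: (a) for some $k\in\mathbb{N}=\{0,1,2,\dots\}$, the set of eigenvalues of $\xi$ (acting on $\mathbb{C}^n$) is exactly $\{\pm\sqrt{-1}\,j : j\in\mathbb{Z},\ 0\leq j\leq k\}$; or (b) for some $k\in\mathbb{N}=\{0,1,2,\dots\}$, the set of eigenvalues of $\xi$ (acting on $\mathbb{C}^n$) is exactly $\{\pm\sqrt{-1}\,(j+\tfrac12) : j\in\mathbb{Z},\ 0\leq j\leq k\}$ and the eigenvalues $\pm\tfrac12\sqrt{-1}$ each have multiplicity at least $2$.
   Context: $\mathfrak{so}(n)$ is the compact real Lie algebra of real skew-symmetric $n\times n$ matrices, acting on $\mathbb{R}^n$ and on $\mathbb{C}^n=(\mathbb{R}^n)^{\mathbb{C}}$; eigenvalues of $\xi$ and their multiplicities are those of $\xi$ as an endomorphism of $\mathbb{C}^n$. Write $\mathfrak{g}=\mathfrak{so}(n)$, a compact semisimple Lie algebra, with complexification $\mathfrak{g}^{\mathbb{C}}$. A subalgebra $\mathfrak{q}\leq\mathfrak{g}^{\mathbb{C}}$ is parabolic if it contains a maximal solvable subalgebra of $\mathfrak{g}^{\mathbb{C}}$; equivalently, if the polar $\mathfrak{q}^{\perp}$ of $\mathfrak{q}$ with respect to the Killing form of $\mathfrak{g}^{\mathbb{C}}$ is a nilpotent subalgebra. In that case $\mathfrak{q}^{\perp}$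 is the nilradical of $\mathfrak{q}$. The whole algebra $\mathfrak{g}^{\mathbb{C}}$ counts as a parabolic subalgebra (with nilradical $\{0\}$). Canonical element: let $\mathfrak{q}\leq\mathfrak{g}^{\mathbb{C}}$ be parabolic with nilradical $\mathfrak{n}=\mathfrak{q}^{\perp}$, and let $\mathfrak{n}^{(r)}$, $r\geq1$, be its central descending series: $\mathfrak{n}^{(1)}=\mathfrak{n}$ and $\mathfrak{n}^{(r+1)}=[\mathfrak{n},\mathfrak{n}^{(r)}]$ for $r\geq 1$. By a theorem of Burstall and Rawnsley, there is a unique $\xi\in\mathfrak{g}$, called the canonical element of $\mathfrak{q}$, such that: (i) the eigenvalues of $\operatorname{ad}\xi$ on $\mathfrak{g}^{\mathbb{C}}$ lie in $\sqrt{-1}\,\mathbb{Z}$; (ii) writing $\mathfrak{g}_i$ for the $\sqrt{-1}\,i$-eigenspace of $\operatorname{ad}\xi$ in $\mathfrak{g}^{\mathbb{C}}$, $i\in\mathbb{Z}$, one has $\mathfrak{q}=\sum_{i\geq0}\mathfrak{g}_i$ and $\mathfrak{n}^{(r)}=\sum_{i\geq r}\mathfrak{g}_i$ for all $r\geq1$. *)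

(* Defs.v *)
From HB Require Import structures.
From mathcomp Require Import all_boot all_order all_algebra.
From mathcomp Require Import reals.
From mathcomp Require Import complex.

Set Implicit Arguments.
Unset Strict Implicit.
Unset Printing Implicit Defensive.

Import Order.TTheory GRing.Theory Num.Theory.

Local Open Scope ring_scope.

Section LieMatrixAlgebras.

Variables (F : fieldType) (n : nat).

Implicit Types (x y : 'M[F]_n) (U V W : {vspace 'M[F]_n}).

Definition lie x y : 'M[F]_n := x *m y - y *m x.

Definition ad x : 'End('M[F]_n) := linfun (lie x).

Fact lie_is_linear x : linear (lie x).
Proof.
move=> a y z; rewrite /lie mulmxDr mulmxDl -scalemxAr -scalemxAl.
by rewrite scalerBr opprD addrACA.
Qed.

HB.instance Definition _ x :=
  GRing.isLinear.Build F 'M[F]_n 'M[F]_n *:%R (lie x) (lie_is_linear x).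

Lemma adE x y : ad x y = lie x y.
Proof. exact: lfunE. Qed.

Lemma lieC x y : lie x y = - lie y x.
Proof. by rewrite /lie opprB. Qed.

Lemma lie_linearl a x y z : lie (a *: x + y) z = a *: lie x z + lie y z.
Proof. by rewrite lieC linearP opprD -scalerN -!lieC. Qed.

(* [U, V]: the span of all brackets; by bilinearity, brackets of basis elements
   suffice (see lie_spaceP). *)
Definition lie_space U V : {vspace 'M[F]_n} :=
  <<[seq lie x y | x <- vbasis U, y <- vbasis V]>>%VS.

Lemma memv_lie U V x y : x \in U -> y \in V -> lie x y \in lie_space U V.
Proof.
move=> xU yV; rewrite (coord_vbasis yV) raddf_sum /= memv_suml // => j _.
rewrite linearZ /= memvZ // lieC (coord_vbasis xU) raddf_sum /= memvN.
rewrite memv_suml // => i _; rewrite linearZ /= memvZ // lieC memvN.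
by apply: memv_span; apply: allpairs_f; rewrite memt_nth.
Qed.

Lemma lie_spaceP U V W :
  reflect (forall x y, x \in U -> y \in V -> lie x y \in W)
          (lie_space U V <= W)%VS.
Proof.
apply: (iffP idP) => [sW x y xU yV | sW].
  by apply: (subvP sW); apply: memv_lie.
apply/span_subvP => _ /allpairsP[[x y] /= [xU yV ->]].
by apply: sW; apply: vbasis_mem.
Qed.

Definition lie_subalgebra (g q : {vspace 'M[F]_n}) : Prop :=
  (q <= g)%VS /\ (lie_space q q <= q)%VS.

Definition lie_solvable (b : {vspace 'M[F]_n}) : Prop :=
  exists k : nat, iter k (fun U => lie_space U U) b = 0%VS.

Definition maximal_solvable (g b : {vspace 'M[F]_n}) : Prop :=
  [/\ lie_subalgebra g b, lie_solvable b &
      forall b' : {vspace 'M[F]_n},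
        lie_subalgebra g b' -> lie_solvable b' -> (b <= b')%VS -> b' = b].

Definition parabolic (g q : {vspace 'M[F]_n}) : Prop :=
  lie_subalgebra g q /\
  exists b : {vspace 'M[F]_n}, maximal_solvable g b /\ (b <= q)%VS.

(* The trace of ad x \o ad y on g, computed in a basis of g. *)
Definition killing (g : {vspace 'M[F]_n}) x y : F :=
  \sum_(i < \dim g) coord (vbasis g) i (ad x (ad y (vbasis g)`_i)).

Fact killing_is_scalar g x : scalar (killing g x).
Proof.
move=> a y z; rewrite /killing mulr_sumr -big_split /=.
apply: eq_bigr => i _.
by rewrite !adE lie_linearl linearP linearP.
Qed.

HB.instance Definition _ g x :=
  GRing.isLinear.Build F 'M[F]_n F *%R (killing g x) (killing_is_scalar g x).

(* The orthogonal of q in g for the Killing form of g (see memv_polar). *)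
Definition polar (g q : {vspace 'M[F]_n}) : {vspace 'M[F]_n} :=
  (g :&: \bigcap_(i < \dim q)
     lker (linfun (fun x => killing g (vbasis q)`_i x : F^o)))%VS.

Lemma memv_polar g q x :
  x \in polar g q <-> x \in g /\ (forall y, y \in q -> killing g y x = 0).
Proof.
have killingDl a y1 y2 z :
    killing g (a *: y1 + y2) z = a * killing g y1 z + killing g y2 z.
  rewrite /killing mulr_sumr -big_split /=; apply: eq_bigr => i _.
  by rewrite -linearP !adE lie_linearl.
have killing0l z : killing g 0 z = 0.
  by apply: (addrI (killing g 0 z)); rewrite -{1}[killing g 0 z]mul1r
     -killingDl scaler0 !addr0.
have memE : x \in polar g q =
    (x \in g) && [forall i : 'I_(\dim q), killing g (vbasis q)`_i x == 0].
  rewrite memv_cap; congr (_ && _).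
  rewrite memvE; apply/subv_bigcapP/forallP => [h i | h i _].
    by move: (h i isT); rewrite -memvE memv_ker lfunE.
  by rewrite -memvE memv_ker lfunE /=.
rewrite memE; split=> [/andP[xg /forallP h] | [xg h]].
  split=> // y yq; rewrite (coord_vbasis yq).
  apply: (big_ind (fun u => killing g u x = 0)) => // [u v hu hv | i _].
    by rewrite -[u]scale1r killingDl hu hv mulr0 addr0.
  by rewrite -[_ *: _]addr0 killingDl (eqP (h i)) mulr0 killing0l addr0.
rewrite xg; apply/forallP => i; rewrite h //.
by apply: vbasis_mem; rewrite memt_nth.
Qed.

(* The central descending series, indexed from 1 as n^(1) = n. *)
Definition central_descending (nn : {vspace 'M[F]_n}) (r : nat) :
    {vspace 'M[F]_n} :=
  iter r.-1 (lie_space nn) nn.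

End LieMatrixAlgebras.

Definition so (F : fieldType) (n : nat) : {vspace 'M[F]_n} :=
  lker (linfun (fun A : 'M[F]_n => A^T + A)).

Lemma memv_so (F : fieldType) n (A : 'M[F]_n) : (A \in so F n) = (A^T == - A).
Proof.
pose f (B : 'M[F]_n) := B^T + B.
have fL : linear f.
  by move=> a B D; rewrite /f linearP /= scalerDr addrACA.
pose fm := GRing.isLinear.Build F 'M[F]_n 'M[F]_n *:%R f fL.
pose fl : {linear 'M[F]_n -> 'M[F]_n} := HB.pack f fm.
by rewrite memv_ker (lfunE fl) /= /f addr_eq0.
Qed.

Section Canonical.

Variables (R : realType) (n : nat).

(* xi as an endomorphism of C^n.  The library's [eigenvalue] and [eigenspace] use
   row vectors; a square matrix and its transpose have the same eigenvalues, with
   the same multiplicities. *)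
Definition complexify (A : 'M[R]_n) : 'M[R[i]]_n := map_mx (real_complex R) A.

(* so(n)^C is taken to be the skew-symmetric complex matrices. *)
Lemma so_complexification (A : 'M[R[i]]_n) :
  A \in so R[i] n <->
  exists X Y : 'M[R]_n,
    [/\ X \in so R n, Y \in so R n & A = complexify X + 'i *: complexify Y].
Proof.
split=> [|[X [Y [+ + ->]]]]; rewrite !memv_so; last first.
  move=> /eqP/matrixP hX /eqP/matrixP hY; apply/eqP/matrixP => i j.
  move: (hX i j) (hY i j); rewrite !mxE => -> ->.
  by rewrite !rmorphN /= mulrN opprD.
move=> /eqP hA; exists (map_mx (@complex.Re R) A), (map_mx (@complex.Im R) A).
have hE i j : A j i = - A i j by move: hA => /matrixP/(_ i j); rewrite !mxE.
split; last 1 first.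
- by apply/matrixP => i j; rewrite !mxE -complexiE -complexE.
- by rewrite memv_so; apply/eqP/matrixP => i j; rewrite !mxE hE raddfN.
- by rewrite memv_so; apply/eqP/matrixP => i j; rewrite !mxE hE raddfN.
Qed.

(* The 'i * a eigenspace of ad xi in so(n)^C. *)
Definition grading_space (xi : 'M[R]_n) (a : int) : {vspace 'M[R[i]]_n} :=
  (so R[i] n :&: passmx.leigenspace (ad (complexify xi)) ('i * a%:~R))%VS.

(* Membership in \sum_(i >= r) g_i; such an infinite sum of subspaces is the
   increasing union of its finite partial sums. *)
Definition in_filtration (xi : 'M[R]_n) (r : nat) (x : 'M[R[i]]_n) : Prop :=
  exists m : nat, x \in (\sum_(r <= j < m) grading_space xi j%:Z)%VS.

Definition canonical_element (q : {vspace 'M[R[i]]_n}) (xi : 'M[R]_n) : Prop :=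
  [/\ xi \in so R n,
      forall z : R[i],
        (so R[i] n :&: passmx.leigenspace (ad (complexify xi)) z != 0)%VS ->
        exists a : int, z = 'i * a%:~R,
      forall x : 'M[R[i]]_n, x \in q <-> in_filtration xi 0 x &
      forall (r : nat) (x : 'M[R[i]]_n), (1 <= r)%N ->
        x \in central_descending (polar (so R[i] n) q) r <->
        in_filtration xi r x].

Definition canonical (xi : 'M[R]_n) : Prop :=
  exists q : {vspace 'M[R[i]]_n},
    parabolic (so R[i] n) q /\ canonical_element q xi.

End Canonical.

(* Main.v *)
(* Diagonalise xi over C as Q diag(i d_k) Q^-1; the d_k are the weights.  Under
   so(n)^C = Lambda^2 C^n the eigenvalues of ad xi are the i (d_k + d_l), k != l,
   and the bilinear form x^T y pairs only opposite weight spaces.  If all d_k + d_l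
   are integers, then q = \sum_(j >= 0) g_j is parabolic and its polar is
   \sum_(j >= 1) g_j, so xi is canonical if and only if g_(r+1) = [g_1, g_r] for all
   r >= 1.  For d_i + d_j = r + 1 with d_i >= d_j one has, writing e_l^* for the
   dual of e_l,
     e_i /\ e_j = [e_i /\ e_l^*, e_l /\ e_j]   whenever d_l = d_i - 1, l != j;
   conversely a bracket of g_1 and g_r has an e_i /\ e_j component only if some
   intermediate weight exists.  What remains is combinatorics of the multiset of
   weights: it has no gaps, and the weight 1/2 cannot be simple. *)

From HB Require Import structures.
From mathcomp Require Import all_boot all_order all_algebra.
From mathcomp Require Import perm reals complex boolp.
From mathcomp Require Import ring zify.
Require Import Defs.

Set Implicit Arguments.
Unset Strict Implicit.
Unset Printing Implicit Defensive.

Import Order.TTheory GRing.Theory Num.Theory.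
Local Open Scope ring_scope.

(** * Brackets and the Killing form of so(n) *)

Section LieAlgebra.
Variables (F : fieldType) (n : nat).
Implicit Types (x y z : 'M[F]_n) (U V W b g : {vspace 'M[F]_n}).

Lemma lie_linearr a x y z : lie x (a *: y + z) = a *: lie x y + lie x z.
Proof. exact: linearP. Qed.

Lemma mxtrace_lieA x y z : \tr (lie x y *m z) = \tr (x *m lie y z).
Proof.
rewrite /lie mulmxBl mulmxBr !raddfB /= !mulmxA.
by rewrite -[y *m x *m z]mulmxA (mxtrace_mulC y).
Qed.

Lemma mem_ad_eigenspace (c : F) x y :
  (y \in passmx.leigenspace (ad x) c) <-> lie x y = c *: y.
Proof.
rewrite memv_ker add_lfunE opp_lfunE scale_lfunE id_lfunE adE subr_eq0.
by split=> /eqP.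
Qed.

Lemma lie_so x y : x \in so F n -> y \in so F n -> lie x y \in so F n.
Proof.
rewrite !memv_so => /eqP hx /eqP hy; apply/eqP.
by rewrite /lie linearB /= !trmx_mul hx hy !mulNmx !mulmxN !opprK opprB.
Qed.

Lemma lie_spaceS U U' V V' :
  (U <= U')%VS -> (V <= V')%VS -> (lie_space U V <= lie_space U' V')%VS.
Proof.
move=> sU sV; apply/lie_spaceP => x y xU yV.
by apply: memv_lie; [apply: (subvP sU) | apply: (subvP sV)].
Qed.

(* The trace of f on g, computed on the standard basis of all matrices. *)
Lemma trace_on_retract g (p : 'End('M[F]_n)) (f : 'End('M[F]_n)) :
  (forall z, p z \in g) -> {in g, forall z, p z = z} ->
  {in g, forall z, f z \in g} ->
  \sum_(i < \dim g) coord (vbasis g) i (f (vbasis g)`_i) =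
  \sum_k \sum_l f (p (delta_mx k l)) k l.
Proof.
move=> pg pid fg.
transitivity (\sum_k \sum_l \sum_(i < \dim g)
    coord (vbasis g) i (p (delta_mx k l)) * f (vbasis g)`_i k l); last first.
  apply: eq_bigr => k _; apply: eq_bigr => l _.
  rewrite [in RHS](coord_vbasis (pg _)) linear_sum summxE.
  by apply: eq_bigr => i _; rewrite linearZ mxE.
under [RHS]eq_bigr => k _ do rewrite exchange_big /=.
rewrite [RHS]exchange_big /=; apply: eq_bigr => i _.
have hi : f (vbasis g)`_i \in g by apply/fg/vbasis_mem; rewrite memt_nth.
rewrite -{1}(pid _ hi) [in LHS](matrix_sum_delta (f _)) !linear_sum /=.
apply: eq_bigr => k _; rewrite !linear_sum /=; apply: eq_bigr => l _.
by rewrite !linearZ /= mulrC.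
Qed.

Lemma mxtrace_delta_mul (X : 'M[F]_n) (k l : 'I_n) : \tr (delta_mx k l *m X) = X l k.
Proof.
rewrite /mxtrace (bigD1 k) //= big1 ?addr0 => [|m mk]; rewrite mxE.
  rewrite (bigD1 l) //= big1 ?addr0 => [|m ml]; first by rewrite mxE !eqxx mul1r.
  by rewrite mxE (negPf ml) andbF mul0r.
by rewrite big1 // => p _; rewrite mxE (negPf mk) mul0r.
Qed.

Lemma delta_mul_entry (X : 'M[F]_n) (k l p q : 'I_n) :
  (delta_mx k l *m X) p q = (p == k)%:R * X l q.
Proof.
rewrite mxE (bigD1 l) //= big1 ?addr0 => [|m ml]; first by rewrite mxE eqxx andbT.
by rewrite mxE (negPf ml) andbF mul0r.
Qed.

Lemma mul_delta_entry (X : 'M[F]_n) (k l p q : 'I_n) :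
  (X *m delta_mx k l) p q = X p k * (q == l)%:R.
Proof.
rewrite mxE (bigD1 k) //= big1 ?addr0 => [|m mk]; first by rewrite mxE eqxx.
by rewrite mxE (negPf mk) mulr0.
Qed.

(** [H *m E *m H] is dual to [E] for the trace form in coordinates with Gram matrix [G], which is
    how nondegeneracy is tested later. *)
Lemma mxtrace_dual (G H X E : 'M[F]_n) : G *m H = 1%:M ->
  \tr (H *m E *m H *m G *m X *m G) = \tr (E *m X).
Proof.
move=> GH; rewrite mxtrace_mulC !mulmxA GH mul1mx -(mulmxA E) (mulmx1C GH).
by rewrite mulmx1.
Qed.

(** In the first product [H] cancels [G], leaving [delta_mx i l *m delta_mx l j]; the other terms
    vanish by [G i l = G i j = 0] and [l != j]. The second product is its transpose. *)
Lemma raise_bracket (G H : 'M[F]_n) (i j l : 'I_n) :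
  G^T = G -> H^T = H -> G *m H = 1%:M -> G i l = 0 -> G i j = 0 -> l != j ->
  (delta_mx i l *m H - H *m delta_mx l i) *m G *m (delta_mx l j - delta_mx j l) -
  (delta_mx l j - delta_mx j l) *m G *m (delta_mx i l *m H - H *m delta_mx l i) =
  delta_mx i j - delta_mx j i.
Proof.
move=> GT HT /mulmx1C HG il ij lj.
have dgd (k m : 'I_n) : delta_mx l i *m G *m delta_mx k m = G i k *: delta_mx l m.
  apply/matrixP => a b; rewrite mul_delta_entry delta_mul_entry !mxE.
  by rewrite mulrAC mulrC -natrM mulnb andbC.
set X := delta_mx i l *m H - _; set Y := delta_mx l j - _.
have XGY : X *m G *m Y = delta_mx i j.
  rewrite /X 2!mulmxBl -(mulmxA _ H) HG mulmx1 -!(mulmxA H).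
  rewrite /Y !mulmxBr !dgd il ij !scale0r !mulmx0 !subr0.
  by rewrite mul_delta_mx mul_delta_mx_0 ?subr0.
have XT : X^T = - X by rewrite /X raddfB /= !trmx_mul HT !trmx_delta opprB.
have YT : Y^T = - Y by rewrite /Y raddfB /= !trmx_delta opprB.
have YGX : Y *m G *m X = delta_mx j i.
  by rewrite -trmx_delta -XGY !trmx_mul GT XT YT mulNmx !mulmxN opprK mulmxA.
by rewrite XGY YGX.
Qed.

(** The left side is the trace of z |-> a z b on all matrices; the next lemma treats z |-> a z^T
    b. *)
Lemma sum_mul_delta_mul (a b : 'M[F]_n) :
  \sum_k \sum_l (a *m delta_mx k l *m b) k l = \tr a * \tr b.
Proof.
rewrite /mxtrace mulr_suml; apply: eq_bigr => k _.
rewrite mulr_sumr; apply: eq_bigr => l _.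
rewrite !mxE (bigD1 l) //= big1 ?addr0 => [|m ml].
  rewrite !mxE (bigD1 k) //= big1 ?addr0 => [|m mk]; first by rewrite !mxE !eqxx mulr1.
  by rewrite !mxE (negPf mk) mulr0.
rewrite !mxE big1 ?mul0r // => q _.
by rewrite !mxE (negPf ml) andbF mulr0.
Qed.

Lemma sum_mul_tr_delta_mul (a b : 'M[F]_n) :
  \sum_k \sum_l (a *m (delta_mx k l)^T *m b) k l = \tr (a *m b^T).
Proof.
rewrite /mxtrace; apply: eq_bigr => k _; rewrite [in RHS]mxE.
apply: eq_bigr => l _; rewrite trmx_delta.
rewrite !mxE (bigD1 k) //= big1 ?addr0 => [|m mk].
  rewrite !mxE (bigD1 l) //= big1 ?addr0 => [|m ml]; first by rewrite !mxE !eqxx mulr1.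
  by rewrite !mxE (negPf ml) mulr0.
rewrite !mxE big1 ?mul0r // => q _.
by rewrite !mxE (negPf mk) andbF mulr0.
Qed.

(** The trace on so(n) is that of [f] composed with the projection z |-> (z - z^T) / 2. As tr x = tr
    y = 0, the plain terms of ad x ad y contribute 2 n tr (x y) and the transposed ones 4 tr (x y);
    half the difference remains. *)
Lemma killing_so x y : (2 : F) != 0 -> x \in so F n -> y \in so F n ->
  killing (so F n) x y = (n%:R - 2) * \tr (x *m y).
Proof.
move=> nz2 xg yg.
pose p0 z : 'M[F]_n := 2^-1 *: (z - z^T).
have pL : linear p0.
  move=> a u v; rewrite /p0 linearP /= scalerA mulrC -scalerA -scalerDr.
  by congr (_ *: _); rewrite scalerBr opprD addrACA.
pose pm := GRing.isLinear.Build F 'M[F]_n 'M[F]_n *:%R p0 pL.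
pose pl : {linear 'M[F]_n -> 'M[F]_n} := HB.pack p0 pm.
pose f := (ad x \o ad y)%VF.
have fE z : f z = x *m y *m z - x *m z *m y - y *m z *m x + 1%:M *m z *m (y *m x).
  by rewrite /f comp_lfunE !adE /lie mulmxBr mulmxBl mul1mx !mulmxA opprB addrA addrAC
    [_ - y *m z *m x]addrC [in RHS]addrAC [in RHS]addrAC addrA.
have -> : killing (so F n) x y =
    \sum_(i < \dim (so F n)) coord (vbasis (so F n)) i (f (vbasis (so F n))`_i).
  by apply: eq_bigr => i _; rewrite /f comp_lfunE.
rewrite (@trace_on_retract _ (linfun pl) f); first last.
- by move=> z zg; rewrite /f comp_lfunE !adE; do 2! apply: lie_so => //.
- move=> z; rewrite memv_so lfunE /= /p0 => /eqP ->.
  by rewrite opprK -mulr2n -scaler_nat scalerA mulVf // scale1r.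
- move=> z; rewrite memv_so lfunE /= /p0; apply/eqP.
  by rewrite linearZ /= linearB /= trmxK -scalerN opprB.
have -> : \sum_k \sum_l f (linfun pl (delta_mx k l)) k l =
  2^-1 * (\sum_k \sum_l f (delta_mx k l) k l - \sum_k \sum_l f ((delta_mx k l)^T) k l).
  rewrite -sumrB mulr_sumr; apply: eq_bigr => k _.
  rewrite -sumrB mulr_sumr; apply: eq_bigr => l _.
  by rewrite (lfunE pl) /= /p0 linearZ linearB !mxE.
have hs (h : 'I_n -> 'I_n -> 'M[F]_n) : \sum_k \sum_l f (h k l) k l =
   \sum_k \sum_l (x *m y *m h k l *m 1%:M) k l
   - \sum_k \sum_l (x *m h k l *m y) k l - \sum_k \sum_l (y *m h k l *m x) k l
   + \sum_k \sum_l (1%:M *m h k l *m (y *m x)) k l.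
  rewrite -!sumrB -big_split; apply: eq_bigr => k _.
  rewrite -!sumrB -big_split; apply: eq_bigr => l _.
  by rewrite fE mulmx1 !mxE.
move: xg yg; rewrite !memv_so => /eqP hx /eqP hy.
have tr0 z : z^T = - z -> \tr z = 0.
  move=> hz; have := mxtrace_tr z; rewrite hz raddfN /= => /eqP.
  by rewrite eq_sym -addr_eq0 -mulr2n -mulr_natl mulf_eq0 (negPf nz2) => /eqP.
rewrite !hs !sum_mul_delta_mul !sum_mul_tr_delta_mul (tr0 _ hx) (tr0 _ hy).
rewrite trmx1 mulmx1 mul1mx trmx_mul hx hy mulNmx !mulmxN opprK !raddfN /=.
rewrite mxtrace1 (mxtrace_mulC y x).
by field.
Qed.

(** * Derived series, invariant subspaces and maximal subspaces *)

Definition derived b k := iter k (fun U => lie_space U U) b.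

Lemma derivedS b k : derived b k.+1 = lie_space (derived b k) (derived b k).
Proof. by []. Qed.

Lemma derived_decr b k : (lie_space b b <= b)%VS -> (derived b k.+1 <= derived b k)%VS.
Proof. by move=> hb; elim: k => // k IH; apply: lie_spaceS. Qed.

(** Applying f - e j to the sum kills [c j] and scales every other [c i] by the nonzero e i - e j,
    so induction on [l] applies; [c j] is what remains. *)
Lemma stable_component (I : eqType) (f : 'End('M[F]_n)) b (l : seq I) (e : I -> F)
    (c : I -> 'M[F]_n) :
  injective e -> uniq l -> (forall y, y \in b -> f y \in b) ->
  (forall i, f (c i) = e i *: c i) ->
  \sum_(i <- l) c i \in b -> {in l, forall i, c i \in b}.
Proof.
move=> einj + fb; elim: l c => [|j l IH] c //= /andP[jl ul] fc.
rewrite big_cons => hs.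
have hl i : i \in l -> c i \in b.
  move=> il; have ne : e i - e j != 0.
    by rewrite subr_eq0; apply: contraNneq jl => /einj <-.
  have := IH (fun i => (e i - e j) *: c i) ul _ _ i il.
  have -> : (e i - e j) *: c i \in b = (c i \in b).
    by rewrite rpredZeq (negPf ne).
  apply=> [k|]; first by rewrite linearZ /= fc !scalerA mulrC.
  rewrite (_ : \sum_(i <- l) _ =
     f (c j + \sum_(i <- l) c i) - e j *: (c j + \sum_(i <- l) c i)).
    by rewrite rpredB ?memvZ ?fb.
  rewrite linearD linear_sum /= fc scalerDr opprD addrACA subrr add0r.
  rewrite scaler_sumr -sumrB; apply: eq_bigr => k _.
  by rewrite fc scalerBl.
move=> i; rewrite inE => /orP[/eqP->|]; last exact: hl.
move: hs; rewrite addrC; apply: contraLR => nc.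
by rewrite rpredDl // big_seq; apply: rpred_sum.
Qed.

(** Induction on the codimension of [b0], which drops whenever a strictly larger subspace satisfies
    [Pr]. *)
Lemma exists_maximal_subv (Pr : {vspace 'M[F]_n} -> Prop) b0 : Pr b0 ->
  exists b, [/\ Pr b, (b0 <= b)%VS & forall b', Pr b' -> (b <= b')%VS -> b' = b].
Proof.
have [m] := ubnP (\dim {: 'M[F]_n} - \dim b0)%N.
elim: m b0 => // m IH b0; rewrite ltnS => hm Pb0.
have [h|h] := pselect (forall b', Pr b' -> (b0 <= b')%VS -> b' = b0).
  by exists b0; split.
have [b1 [Pb1 s01 ne]] : exists b1, [/\ Pr b1, (b0 <= b1)%VS & b1 <> b0].
  apply: contrapT => h'; apply: h => b' Pb' s; apply: contrapT => ne.
  by apply: h'; exists b'.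
have lt : (\dim b0 < \dim b1)%N.
  rewrite ltn_neqAle dimvS // andbT; apply: contra_not_neq ne => e.
  by apply/eqP; rewrite eq_sym eqEdim s01 e /=.
have [] := IH b1 => // [|b [Pb s1 hb]]; last first.
  by exists b; split => //; apply: subv_trans s1.
apply: leq_trans hm; rewrite ltn_sub2l //; apply: leq_trans lt _.
exact/dimvS/subvf.
Qed.

End LieAlgebra.

(** * Combinatorics of the weights *)

Section Ladder.
(* w is twice the weight d, so that half-integral weights become integers. *)
Variables (n : nat) (w : 'I_n -> int).
Hypothesis parity : forall i j, exists c : int, w i - w j = 2 * c.

Lemma exists_max_weight (Pr : pred 'I_n) i0 : Pr i0 ->
  exists2 i, Pr i & forall j, Pr j -> w j <= w i.
Proof. by move=> P0; case: (@arg_maxP _ _ _ i0 Pr w P0) => i Pi h; exists i. Qed.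

Lemma exists_min_weight (Pr : pred 'I_n) i0 : Pr i0 ->
  exists2 i, Pr i & forall j, Pr j -> w i <= w j.
Proof. by move=> P0; case: (@arg_minP _ _ _ i0 Pr w P0) => i Pi h; exists i. Qed.

(** Lower the larger weight, say [w i], unless [w j = w i - 2], when the index found could be [j]
    itself. Then lower [w j] instead, except for [w j = 1], where a second index of weight 1 takes
    the place of [j]. *)
Lemma ladder_step : (forall i, 2 <= w i -> exists l, w l = w i - 2) ->
  (forall j, w j = 1 -> exists2 l, l != j & w l = 1) ->
  forall i j, i != j -> 4 <= w i + w j ->
  (exists l, [/\ l != j, w l = w i - 2 & w i + w l != 0]) \/
  (exists l, [/\ l != i, w l = w j - 2 & w j + w l != 0]).
Proof.
move=> down dbl.
have main i j : w j <= w i -> 4 <= w i + w j ->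
  (exists l, [/\ l != j, w l = w i - 2 & w i + w l != 0]) \/
  (exists l, [/\ l != i, w l = w j - 2 & w j + w l != 0]).
  move=> ji h4; have [|l hl] := down i; first by lia.
  have [e|ne] := eqVneq (w j) (w i - 2); last first.
    left; exists l; split; [|done|lia].
    by apply: contraNneq ne => <-; rewrite hl.
  have [e1|ne1] := eqVneq (w j) 1.
    by have [m mj hm] := dbl _ e1; left; exists m; split; [done|lia|lia].
  have [|m hm] := down j; first by lia.
  right; exists m; split; [|done|lia].
  by apply/eqP => mi; move: hm; rewrite mi; lia.
move=> i j _ h4; have [h|h] := leP (w j) (w i); first exact: main.
by case: (main j i); [lia|lia|right|left].
Qed.

Variable s : 'I_n -> 'I_n.
Hypothesis s_inj : injective s.
Hypothesis sN : forall i, w (s i) = - w i.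

Lemma weight_ladder i (t : nat) : (forall i, 2 <= w i -> exists l, w l = w i - 2) ->
  t%:Z * 2 <= w i -> exists l, w l = w i - t%:Z * 2.
Proof.
move=> down; elim: t => [|t IH] h; first by exists i; lia.
have [|l hl] := IH; first by lia.
by have [|m hm] := down l; [lia | exists m; lia].
Qed.

Hypothesis n_ge3 : (3 <= n)%N.

(** Since n >= 3, some [m] differs from [i] and [s i]. Both [w i] and [- w i] are simple and no
    weight lies strictly between them, so [w m] or [w (s m)] exceeds [w i]. *)
Lemma next_weight i : 0 < w i -> (forall j, w j = w i -> j = i) ->
  (forall j, - w i < w j -> w i <= w j) ->
  exists2 c, w i < w c & forall j, w i < w j -> w c <= w j.
Proof.
move=> wi0 wi1 gap.
have /subsetPn[m _ hm] : ~~ ([set: 'I_n] \subset [set i; s i]).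
  apply/negP => /subset_leq_card; rewrite cardsT card_ord cards2.
  by case: (_ != _) n_ge3; lia.
move: hm; rewrite !inE negb_or => /andP[mi msi].
have m1 : w m != w i by apply: contra_neq mi => /wi1.
have m2 : w m != - w i.
  apply: contra_neq msi => e; apply: s_inj.
  have -> : s m = i by apply: wi1; rewrite sN e opprK.
  by apply/esym/wi1; rewrite !sN opprK.
have [c hc] : exists c, w i < w c.
  have [hm|hm] := ltP (w i) (w m); first by exists m.
  have [g|g] := ltP (- w i) (w m).
    by move/eqP: m1; case; apply/eqP; rewrite eq_le hm gap.
  exists (s m); rewrite sN ltrNr lt_neqAle g andbT.
  exact: m2.
have [c' h1 h2] := exists_min_weight (Pr := fun j => w i < w j) hc.
by exists c'.
Qed.

(** What g_(r+1) = [g_1, g_r] says about weights: a nonzero (i, j) entry of a bracket passes through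
    opposite weights [w p] and [w q]. *)
Hypothesis generated : forall i j, i != j -> 4 <= w i + w j ->
  exists p q, [/\ w p = - w q, p != i, q != j & w i + w p = 2 \/ w q + w j = 2].

(* If w i - 2 is missing, let w j0 be the next lower weight.  Nothing then generates the
   degree w i - w j0, unless w j0 = - w i with w i simple; in that case the next weight
   above w i, present because n >= 3, gives the contradiction. *)
Lemma weight_down i : 2 <= w i -> exists l, w l = w i - 2.
Proof.
move=> wi2; case: (boolP [exists l, w l == w i - 2]) => [/existsP[l /eqP]|/existsPn no].
  by exists l.
have {}no l : w l <> w i - 2 by apply/eqP.
have [j0 j0i j0max] : exists2 j0, w j0 < w i & forall j, w j < w i -> w j <= w j0.
  by apply: (exists_max_weight (Pr := fun j => w j < w i) (i0 := s i)); rewrite sN; lia.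
have far : w j0 + 4 <= w i by have [c] := parity i j0; have := no j0; lia.
have [ij|ij] := eqVneq i (s j0); last first.
  have [|p [q [pq _ _ [h|h]]]] := generated ij; first by rewrite sN; lia.
    by case: (no q); lia.
  have hq : w q = w j0 + 2 by move: h; rewrite sN; lia.
  by have := j0max q; lia.
have wj0 : w j0 = - w i by rewrite ij sN opprK.
(* A second index of weight [w i] would, by generation, force the missing weight [w i - 2] or its
   opposite. *)
case: (boolP [exists k, (k != i) && (w k == w i)]).
  case/existsP => k /andP[ki /eqP ki'].
  have ik : i != k by rewrite eq_sym.
  have [|p [q [pq _ _ [h|h]]]] := generated ik; first by lia.
    by case: (no q); lia.
  by case: (no (s q)); rewrite sN; lia.
move/existsPn => uniq_i.
have {}uniq_i k : w k = w i -> k = i.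
  by move=> e; apply/eqP; have := uniq_i k; rewrite e eqxx andbT negbK.
have [||c ic cmin] := next_weight _ uniq_i; first by lia.
  by move=> j hj; have := j0max j; lia.
have i_c : i != c by apply: contraTneq ic => <-; rewrite ltxx.
have [|p [q [pq pi _ [h|h]]]] := generated i_c; first by lia.
  by case: (no q); lia.
have [e|ne] := eqVneq (w p) (w i); first by rewrite (uniq_i _ e) eqxx in pi.
have [b hb] := parity c i.
by have := cmin p; lia.
Qed.

(** If weight 1 is simple, let [w c] be the next weight. Generating the degree of (i, c) needs an
    index other than [i] of weight 1, or of weight [w c - 2], which is either 1 again or strictly
    between 1 and [w c]. *)
Lemma weight_one_double i : w i = 1 -> exists2 l, l != i & w l = 1.
Proof.
move=> wi; case: (boolP [exists k, (k != i) && (w k == 1)]).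
  by case/existsP => k /andP[ki /eqP ki']; exists k.
move/existsPn => uniq_i.
have {}uniq_i k : w k = w i -> k = i.
  by rewrite wi => e; apply/eqP; have := uniq_i k; rewrite e eqxx andbT negbK.
have [||c ic cmin] := next_weight _ uniq_i; first by lia.
  by move=> j; have [b] := parity i j; lia.
have i_c : i != c by apply: contraTneq ic => <-; rewrite ltxx.
have [b hb] := parity c i.
have [|p [q [pq pi _ h]]] := generated i_c; first by lia.
have [e|ne] := eqVneq (w p) (w i); first by rewrite (uniq_i _ e) eqxx in pi.
have := cmin p; case: h => h; lia.
Qed.

(** The weights are symmetric, so bounded by the maximal one in absolute value. Steps of 2 down from
    the maximum reach every nonnegative value of its parity, [s] gives the opposites, and the parity
    decides the case. *)
Lemma weight_classification :
  (exists k : nat, forall a : int, (exists i, w i = a) <->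
     exists j : nat, (j <= k)%N /\ (a = j%:Z * 2 \/ a = - (j%:Z * 2))) \/
  (exists k : nat, (forall a : int, (exists i, w i = a) <->
     exists j : nat, (j <= k)%N /\ (a = j%:Z * 2 + 1 \/ a = - (j%:Z * 2 + 1))) /\
     exists i j, [/\ i != j, w i = 1 & w j = 1]).
Proof.
have i0 : 'I_n by apply: (@Ordinal _ 0); lia.
have [m _ hm] := exists_max_weight (Pr := predT) (i0 := i0) isT.
have m0 : 0 <= w m by have := hm (s m) isT; rewrite sN; lia.
have bound i : w i <= w m /\ - w i <= w m.
  by split; [exact: hm | rewrite -sN; apply: hm].
have lad t : t%:Z * 2 <= w m -> exists l, w l = w m - t%:Z * 2.
  exact: (weight_ladder weight_down).
have [k [e|e]] : exists k : nat, w m = k%:Z * 2 \/ w m = k%:Z * 2 + 1.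
  by exists (`|w m| %/ 2)%N; lia.
  left; exists k => a; split=> [[i <-]|[j [jk ha]]].
    have [b hb] := parity m i; have [b1 b2] := bound i.
    by exists (`|w i| %/ 2)%N; lia.
  have [|l hl] := lad (k - j)%N; first by lia.
  by case: ha => ->; [exists l; lia | exists (s l); rewrite sN; lia].
right; exists k; split=> [a|].
  split=> [[i <-]|[j [jk ha]]].
    have [b hb] := parity m i; have [b1 b2] := bound i.
    by exists (`|w i| %/ 2)%N; lia.
  have [|l hl] := lad (k - j)%N; first by lia.
  by case: ha => ->; [exists l; lia | exists (s l); rewrite sN; lia].
have [|l hl] := lad k; first by lia.
have [|l' l'l h] := @weight_one_double l; first by lia.
by exists l', l; split=> //; lia.
Qed.

End Ladder.

(** * The grading in an eigenbasis of xi *)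

Section Weights.
Variables (R : realType) (n : nat) (xi : 'M[R]_n).
Variables (P Q : 'M[R[i]]_n) (d : 'I_n -> R[i]).
Hypothesis xiso : xi \in so R n.
Hypothesis PQ : P *m Q = 1%:M.
Let A := complexify xi.
Let D := diag_mx (\row_k ('i * d k)).
Hypothesis AE : A = Q *m D *m P.

Implicit Types (x y X Y : 'M[R[i]]_n).

Let QP : Q *m P = 1%:M. Proof. exact: mulmx1C. Qed.

(* x = \sum_(k, l) (coords x k l) q_k q_l^T for the columns q_k of Q, with Gram
   matrix (q_k^T q_l): coordinates on tensors rather than matrix conjugation, so that
   skew matrices correspond to skew matrices. *)
Definition coords x := P *m x *m P^T.
Definition of_coords X := Q *m X *m Q^T.
Definition gram := Q^T *m Q.
Definition cogram := P *m P^T.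

Let PQT : P^T *m Q^T = 1%:M. Proof. by rewrite -trmx_mul QP trmx1. Qed.
Let QPT : Q^T *m P^T = 1%:M. Proof. by rewrite -trmx_mul PQ trmx1. Qed.

Lemma coordsK x : of_coords (coords x) = x.
Proof. by rewrite /of_coords /coords !mulmxA QP mul1mx -mulmxA PQT mulmx1. Qed.

Lemma of_coordsK X : coords (of_coords X) = X.
Proof. by rewrite /of_coords /coords !mulmxA PQ mul1mx -mulmxA QPT mulmx1. Qed.

Lemma coords_is_linear : linear coords.
Proof.
by move=> a x y; rewrite /coords mulmxDr mulmxDl -scalemxAr -scalemxAl.
Qed.
HB.instance Definition _ :=
  GRing.isLinear.Build _ _ _ _ coords coords_is_linear.

Lemma of_coords_is_linear : linear of_coords.
Proof.
by move=> a x y; rewrite /of_coords mulmxDr mulmxDl -scalemxAr -scalemxAl.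
Qed.
HB.instance Definition _ :=
  GRing.isLinear.Build _ _ _ _ of_coords of_coords_is_linear.

Lemma coordsZ a x k l : coords (a *: x) k l = a * coords x k l.
Proof. by rewrite linearZ [LHS]mxE. Qed.

Lemma coordsD x y k l : coords (x + y) k l = coords x k l + coords y k l.
Proof. by rewrite raddfD [LHS]mxE. Qed.

Lemma gramK : gram *m cogram = 1%:M.
Proof. by rewrite /gram /cogram mulmxA -(mulmxA Q^T) QP mulmx1 QPT. Qed.

Lemma gramC : gram^T = gram. Proof. by rewrite /gram trmx_mul trmxK. Qed.
Lemma cogramC : cogram^T = cogram. Proof. by rewrite /cogram trmx_mul trmxK. Qed.

Lemma coords_mul x y : coords (x *m y) = coords x *m gram *m coords y.
Proof.
rewrite /coords /gram !mulmxA -(mulmxA (P *m x) P^T) PQT mulmx1.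
by rewrite -(mulmxA (P *m x) Q) QP mulmx1.
Qed.

Lemma coords_lie x y :
  coords (lie x y) = coords x *m gram *m coords y - coords y *m gram *m coords x.
Proof. by rewrite /lie raddfB /= !coords_mul. Qed.

Lemma coords_so x : (x \in so _ n) = ((coords x)^T == - coords x).
Proof.
rewrite memv_so; have -> : (coords x)^T = coords x^T.
  by rewrite /coords !trmx_mul trmxK mulmxA.
by rewrite -raddfN /= (can_eq coordsK).
Qed.

Lemma coords_skew x k l : x \in so _ n -> coords x l k = - coords x k l.
Proof. by rewrite coords_so => /eqP/matrixP/(_ k l); rewrite !mxE. Qed.

Lemma coords_diag x k : x \in so _ n -> coords x k k = 0.
Proof.
move=> /(@coords_skew _ k k)/eqP; rewrite -addr_eq0 -mulr2n -mulr_natl mulf_eq0.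
by rewrite pnatr_eq0 => /eqP.
Qed.

Lemma complexify_so : A \in so _ n.
Proof.
move: xiso; rewrite !memv_so => /eqP h; apply/eqP.
apply/matrixP => i j; move: h => /matrixP/(_ i j); rewrite !mxE => ->.
exact: rmorphN.
Qed.

Let AT : A^T = - A.
Proof. by move: complexify_so; rewrite memv_so => /eqP. Qed.

Let AQ : A *m Q = Q *m D. Proof. by rewrite AE -mulmxA PQ mulmx1. Qed.
Let PA : P *m A = D *m P. Proof. by rewrite AE !mulmxA PQ mul1mx. Qed.
Let ii0 : ('i : R[i]) != 0. Proof. exact: neq0Ci. Qed.

Let weight_eq0 (B : 'M[R[i]]_n) k l : D *m B = - (B *m D) -> B k l != 0 -> d k + d l = 0.
Proof.
move=> /matrixP/(_ k l); rewrite mul_diag_mx mul_mx_diag !mxE => h b0.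
apply: (mulfI ii0); apply: (mulIf b0); rewrite mulr0 mul0r mulrDr mulrDl h.
by rewrite [_ * ('i * _)]mulrC addNr.
Qed.

(** Skewness of A makes Q^T A Q = gram D skew, that is, D anticommutes with [gram]. *)
Lemma gram_weight k l : gram k l != 0 -> d k + d l = 0.
Proof.
apply: weight_eq0; have h : gram *m D = Q^T *m A *m Q by rewrite /gram -mulmxA -AQ mulmxA.
rewrite h -[LHS]trmxK trmx_mul tr_diag_mx gramC h !trmx_mul AT trmxK.
by rewrite mulNmx mulmxN mulmxA.
Qed.

Lemma cogram_weight k l : cogram k l != 0 -> d k + d l = 0.
Proof.
apply: weight_eq0; have h : D *m cogram = P *m A *m P^T by rewrite /cogram mulmxA -PA.
rewrite h -[in RHS](trmxK (cogram *m D)) trmx_mul tr_diag_mx cogramC h !trmx_mul AT.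
by rewrite trmxK mulNmx mulmxN opprK mulmxA.
Qed.

(** Since A^T = - A, the commutator with A acts as a derivation on the tensors q_k q_l^T. *)
Lemma coords_ad x k l : coords (lie A x) k l = 'i * (d k + d l) * coords x k l.
Proof.
have -> : coords (lie A x) = D *m coords x + coords x *m D.
  have APT : A *m P^T = - (P^T *m D).
    by rewrite -[A]trmxK AT -trmx_mul mulmxN PA raddfN /= trmx_mul tr_diag_mx.
  rewrite /lie raddfB /= /coords !mulmxA PA -[_ *m A *m P^T]mulmxA APT.
  by rewrite mulmxN opprK !mulmxA.
by rewrite mul_diag_mx mul_mx_diag; move: (coords x) => X; rewrite !mxE; ring.
Qed.

(** * Grading and filtration in coordinates *)

Definition filtered r x := x \in so _ n /\
  forall k l, coords x k l != 0 -> exists m : nat, (r <= m)%N /\ d k + d l = m%:R.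

Lemma ad_eigenP z x : x \in (so R[i] n :&: passmx.leigenspace (ad A) ('i * z))%VS <->
  x \in so _ n /\ forall k l, coords x k l != 0 -> d k + d l = z.
Proof.
rewrite memv_cap; split=> [/andP[xs /mem_ad_eigenspace h]|[xs h]].
  split=> // k l x0; apply: (mulfI ii0); apply: (mulIf x0).
  by rewrite -coords_ad h coordsZ.
apply/andP; split; first exact: xs.
apply/mem_ad_eigenspace; apply: (can_inj coordsK); apply/matrixP => k l.
rewrite coords_ad coordsZ; have [->|x0] := eqVneq (coords x k l) 0.
  by rewrite !mulr0.
by rewrite h.
Qed.

Lemma grading_spaceP a x : x \in grading_space xi a <->
  x \in so _ n /\ forall k l, coords x k l != 0 -> d k + d l = a%:~R.
Proof. exact: ad_eigenP. Qed.

(** The degree [z] is an arbitrary complex number, so that decomposing into components requires no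
    integrality of the sums [d k + d l]. *)
Definition component z x :=
  of_coords (\matrix_(k, l) if d k + d l == z then coords x k l else 0).

Lemma coords_component z x k l :
  coords (component z x) k l = if d k + d l == z then coords x k l else 0.
Proof. by rewrite of_coordsK; move: (coords x) => X; rewrite mxE. Qed.

Lemma component_so z x : x \in so _ n -> component z x \in so _ n.
Proof.
move=> xs; rewrite coords_so; apply/eqP/matrixP => k l.
rewrite [LHS]mxE [RHS]mxE !coords_component addrC (coords_skew k l xs).
by case: eqP; rewrite ?oppr0.
Qed.

Lemma component_grading a x : x \in so _ n ->
  component a%:~R x \in grading_space xi a.
Proof.
move=> xs; apply/grading_spaceP; split; first exact: component_so.
by move=> k l; rewrite coords_component; case: (_ =P a%:~R) => //; rewrite eqxx.
Qed.

Lemma ad_component z x : lie A (component z x) = ('i * z) *: component z x.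
Proof.
apply: (can_inj coordsK); apply/matrixP => k l.
rewrite coords_ad coordsZ !coords_component; case: (_ =P z) => [->//|_].
by rewrite !mulr0.
Qed.

Lemma filteredD r x y : filtered r x -> filtered r y -> filtered r (x + y).
Proof.
move=> [xs hx] [ys hy]; split=> [|k l]; first exact: rpredD.
rewrite coordsD; have [e|/hx//] := eqVneq (coords x k l) 0.
by rewrite e add0r => /hy.
Qed.

Lemma filteredZ r a x : filtered r x -> filtered r (a *: x).
Proof.
move=> [xs hx]; split=> [|k l]; first exact: rpredZ.
by rewrite coordsZ mulf_eq0 negb_or => /andP[_ /hx].
Qed.

Lemma filtered0 r : filtered r 0.
Proof. by split=> [|k l]; rewrite ?rpred0 // raddf0 [X in X != 0]mxE eqxx. Qed.

Lemma filteredW r s x : (s <= r)%N -> filtered r x -> filtered s x.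
Proof.
move=> sr [xs hx]; split=> // k l /hx[m [rm e]]; exists m; split => //.
exact: leq_trans rm.
Qed.

Lemma weight_bound : exists N, forall k l (m : nat), d k + d l = m%:R -> (m < N)%N.
Proof.
have h (kl : 'I_n * 'I_n) : exists N, forall m : nat, d kl.1 + d kl.2 = m%:R -> (m < N)%N.
  have [[m0 e]|ne] := pselect (exists m : nat, d kl.1 + d kl.2 = m%:R).
    exists m0.+1 => m; rewrite e => /eqP; rewrite eqr_nat => /eqP ->.
    exact: ltnSn.
  by exists 0%N => m e; case: ne; exists m.
have /fin_all_exists[f hf] := h.
exists (\max_kl f kl) => k l m e.
by apply: leq_trans (hf (k, l) m e) _; apply: leq_bigmax.
Qed.

Lemma mem_sum_grading r N x : filtered r x ->
  (forall k l (m : nat), d k + d l = m%:R -> (m < N)%N) ->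
  x \in (\sum_(r <= j < N) grading_space xi j%:Z)%VS.
Proof.
move=> [xs hx] hN.
suff -> : x = \sum_(r <= j < N) component j%:R x.
  apply: (big_ind2 (fun u (U : {vspace _}) => u \in U)) => [|u U v V uU vV|j _].
  - exact: mem0v.
  - exact: memv_add.
  - by rewrite -[j%:R]/((j%:Z)%:~R); apply: component_grading.
apply: (can_inj coordsK); rewrite raddf_sum; apply/matrixP => k l.
rewrite summxE; under eq_bigr => j _ do rewrite coords_component.
have [->|x0] := eqVneq (coords x k l) 0.
  by rewrite big1 // => j _; case: ifP.
have [m [rm e]] := hx _ _ x0.
rewrite (bigD1_seq m) ?iota_uniq ?mem_index_iota ?rm ?(hN k l) //= e eqxx.
by rewrite big1 ?addr0 // => j /negPf jm; rewrite eqr_nat eq_sym jm.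
Qed.

Lemma sum_grading_filtered r N x :
  x \in (\sum_(r <= j < N) grading_space xi j%:Z)%VS -> filtered r x.
Proof.
move: x; rewrite big_nat_cond.
elim/big_ind: _ => [x|U V hU hV x|j /andP[/andP[rj _] _] x].
- by rewrite memv0 => /eqP ->; apply: filtered0.
- by case/memv_addP => u uU [v vV ->]; apply: filteredD; [apply: hU | apply: hV].
- by case/grading_spaceP => xs h; split=> // k l /h e; exists j.
Qed.

(** The increasing union stabilises at the bound [N] on the natural numbers among the weight
    sums. *)
Lemma in_filtrationE r x : in_filtration xi r x <-> filtered r x.
Proof.
split=> [[N]|hx]; first exact: sum_grading_filtered.
by have [N hN] := weight_bound; exists N; apply: mem_sum_grading.
Qed.

Lemma filtered_space r : exists V : {vspace 'M[R[i]]_n},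
  forall x, x \in V <-> filtered r x.
Proof.
have [N hN] := weight_bound; exists (\sum_(r <= j < N) grading_space xi j%:Z)%VS => x.
by split; [apply: sum_grading_filtered | move=> h; apply: mem_sum_grading].
Qed.

Lemma triple_entry X Y k l : (X *m gram *m Y) k l != 0 ->
  exists p q, [/\ X k p != 0, d p + d q = 0 & Y q l != 0].
Proof.
move=> h; apply: contrapT => ne; case/eqP: h; rewrite mxE big1 // => q _.
rewrite mxE mulr_suml big1 // => p _.
apply/eqP; apply: contraT; rewrite !mulf_eq0 !negb_or => /andP[/andP[h1 h2] h3].
by case: ne; exists p, q; split=> //; apply: gram_weight.
Qed.

Lemma lie_filtered r s x y : filtered r x -> filtered s y -> filtered (r + s) (lie x y).
Proof.
move=> [xs hx] [ys hy]; split; first exact: lie_so.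
have key X Y r' s' k l :
   (forall k l, X k l != 0 -> exists m : nat, (r' <= m)%N /\ d k + d l = m%:R) ->
   (forall k l, Y k l != 0 -> exists m : nat, (s' <= m)%N /\ d k + d l = m%:R) ->
   (X *m gram *m Y) k l != 0 -> exists m : nat, (r' + s' <= m)%N /\ d k + d l = m%:R.
  move=> hX hY /triple_entry[p [q [/hX[m1 [l1 e1]] pq /hY[m2 [l2 e2]]]]].
  exists (m1 + m2)%N; split; first exact: leq_add.
  by rewrite natrD -e1 -e2 -[LHS]addr0 -pq; ring.
move=> k l; rewrite coords_lie [X in X != 0]mxE [X in _ + X]mxE.
have [->|n0 _] := eqVneq ((coords x *m gram *m coords y) k l) 0; last exact: key n0.
rewrite sub0r oppr_eq0 addnC; exact: key.
Qed.

(** * The polar of the nonnegative part *)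

Lemma mxtrace_coords x : \tr x = \tr (coords x *m gram).
Proof.
rewrite -{1}(coordsK x) /of_coords /gram -mulmxA mxtrace_mulC -!mulmxA.
by rewrite mxtrace_mulC mulmxA.
Qed.

(** As n >= 3, the Killing form is the nonzero multiple (n - 2) tr (y x) of the trace form, which
    pairs degree a only with degree - a, and does so nondegenerately. *)
Lemma polar_filtered (q : {vspace 'M[R[i]]_n}) : (3 <= n)%N ->
  (forall x, x \in q <-> filtered 0 x) ->
  (forall k l, k != l -> exists a : int, d k + d l = a%:~R) ->
  forall x, x \in polar (so _ n) q <-> filtered 1 x.
Proof.
move=> n3 hq hint x.
have nz2 : (2 : R[i]) != 0 by rewrite pnatr_eq0.
have nzn : (n%:R - 2 : R[i]) != 0 by rewrite subr_eq0 eqr_nat; lia.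
have killE y : x \in so _ n -> y \in q ->
    (killing (so _ n) y x == 0) = (\tr (y *m x) == 0).
  by move=> xs /hq[ys _]; rewrite killing_so // mulf_eq0 (negPf nzn).
have trE y : \tr (y *m x) = \tr (coords y *m gram *m coords x *m gram).
  by rewrite mxtrace_coords coords_mul.
split=> [/memv_polar[xs hx]|[xs hx]]; last first.
  apply/memv_polar; split=> // y yq; apply/eqP; rewrite killE // trE.
  rewrite /mxtrace big1 // => k _; rewrite mxE big1 // => m _.
  apply/eqP; apply: contraT; rewrite mulf_eq0 negb_or => /andP[].
  have /hq[_ hy] := yq.
  case/triple_entry => p [s [/hy[m1 [_ e1]] ps /hx[m2 [l2 e2]]]] /gram_weight mk.
  have : m1%:R + m2%:R == (0 : R[i]).
    rewrite -e1 -e2 -(addr0 0) -{1}ps -mk; apply/eqP; ring.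
  by rewrite -natrD pnatr_eq0; lia.
split=> // k l x0.
have kl : k != l by apply: contraNneq x0 => ->; rewrite (coords_diag _ xs).
have [a e] := hint _ _ kl.
have [a0|a0] := ltP 0 a.
  by exists `|a|%N; split; [lia | rewrite e -[in LHS](gtz0_abs a0)].
(* Test against y in q dual to the (k, l) coordinate: tr (y x) = 2 coords x k l. *)
pose E : 'M[R[i]]_n := delta_mx l k - delta_mx k l.
pose y := of_coords (cogram *m E *m cogram).
have yq : y \in q.
  apply/hq; split.
    rewrite coords_so of_coordsK; apply/eqP.
    rewrite trmx_mul cogramC trmx_mul cogramC /E raddfB /= !trmx_delta mulmxA.
    by rewrite -opprB mulmxN mulNmx.
  move=> p s; rewrite of_coordsK /E mulmxBr mulmxBl => h.
  exists `|a|%N; split=> //.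
  have key i j : (cogram *m delta_mx i j *m cogram) p s != 0 ->
     d p + d i = 0 /\ d j + d s = 0.
    rewrite -mulmxA mxE; under eq_bigr => u _ do rewrite delta_mul_entry.
    rewrite (bigD1 i) //= eqxx mul1r big1 ?addr0 => [|u /negPf->]; last by rewrite mul0r mulr0.
    by rewrite mulf_eq0 negb_or => /andP[/cogram_weight -> /cogram_weight ->].
  (* As a <= 0, the degree - (d k + d l) of [y] is a natural number, which puts [y] in [q]. *)
  have ae : (`|a|%N)%:R = - (d k + d l).
    rewrite e -[a in RHS]opprK -(gez0_abs (_ : 0 <= - a)); last by lia.
    by rewrite abszN mulrNz opprK.
  have wt (u v w t : R[i]) : u + v = 0 -> w + t = 0 -> u + t = - (w + v).
    move=> /eqP; rewrite addr_eq0 => /eqP -> /eqP; rewrite addr_eq0 => /eqP ->.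
    by rewrite opprD addrC opprK addrC; ring.
  rewrite ae.
  have [h1|/key[h1 h2]] := eqVneq ((cogram *m delta_mx l k *m cogram) p s) 0.
    move: h; rewrite mxE h1 add0r mxE oppr_eq0 => /key[h2 h3].
    by rewrite (wt _ _ _ _ h2 h3) addrC.
  by rewrite (wt _ _ _ _ h1 h2) addrC.
have := hx _ yq => /eqP; rewrite killE // trE /y of_coordsK.
rewrite (mxtrace_dual _ _ gramK).
rewrite /E mulmxBl raddfB /= !mxtrace_delta_mul (coords_skew k l xs) opprK.
by rewrite -mulr2n -mulr_natl mulf_eq0 (negPf nz2) (negPf x0).
Qed.

(** * Complex conjugation and parabolicity *)

Definition conj_mx x := map_mx (Num.conj : R[i] -> R[i]) x.

Lemma conj_mxK : involutive conj_mx.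
Proof. by move=> x; apply/matrixP => k l; rewrite !mxE conjCK. Qed.

Lemma conj_mx_lie x y : conj_mx (lie x y) = lie (conj_mx x) (conj_mx y).
Proof. by rewrite /lie /conj_mx map_mxB !map_mxM. Qed.

Lemma conj_mx_so x : x \in so _ n -> conj_mx x \in so _ n.
Proof.
rewrite !memv_so => /eqP/matrixP h; apply/eqP/matrixP => k l.
by move: (h k l); rewrite !mxE => ->; rewrite rmorphN.
Qed.

Lemma conj_mx_complexify : conj_mx A = A.
Proof. by apply/matrixP => k l; rewrite !mxE; apply: conjc_real. Qed.

(** For skew [u] this trace is minus the sum of the squared moduli of the entries; here compactness
    of so(n) enters. *)
Lemma mxtrace_conj_eq0 u : u \in so _ n -> \tr (u *m conj_mx u) = 0 -> u = 0.
Proof.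
rewrite memv_so => /eqP/matrixP us tr0; apply/matrixP => k l; rewrite mxE.
have /psumr_eq0P : \sum_(kl : 'I_n * 'I_n) u kl.1 kl.2 * (u kl.1 kl.2)^* = 0.
  transitivity (\sum_k \sum_l u k l * (u k l)^*); first by rewrite pair_bigA.
  apply: oppr_inj; rewrite oppr0 -[RHS]tr0 /mxtrace -sumrN.
  apply: eq_bigr => i _; rewrite mxE -sumrN; apply: eq_bigr => j _.
  rewrite !mxE; move: (us i j); rewrite !mxE => ->.
  by rewrite rmorphN mulrN.
move=> /(_ (fun _ _ => mul_conjC_ge0 _) (k, l) isT)/eqP.
by rewrite mul_conjC_eq0 => /eqP.
Qed.

(* The part L_k of the k-th derived algebra stable under conjugation is commutative,
   by descending induction on k: if u = [z, x] lies in L_(k+1), so does its conjugate u',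
   and tr (u u') = tr (z [x, u']) = 0 forces u = 0. *)
Lemma solvable_conj_commute b : (b <= so _ n)%VS -> (lie_space b b <= b)%VS ->
  lie_solvable b -> forall x y, x \in b -> conj_mx x \in b ->
  y \in b -> conj_mx y \in b -> lie x y = 0.
Proof.
move=> bso bb [K hK].
pose L k x := x \in derived b k /\ conj_mx x \in derived b k.
have LW k x : L k.+1 x -> L k x.
  by case=> h1 h2; split; apply: (subvP (derived_decr k bb)).
have Lso k x : L k x -> x \in so _ n.
  by elim: k => [[h _]|k IH /LW/IH//]; apply: (subvP bso).
have LC k x : L k x -> L k (conj_mx x) by case=> h1 h2; split; rewrite ?conj_mxK.
have Llie k x y : L k x -> L k y -> L k.+1 (lie x y).
  by move=> [x1 x2] [y1 y2]; split; rewrite ?conj_mx_lie; apply: memv_lie.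
have step k : (forall x y, L k.+1 x -> L k.+1 y -> lie x y = 0) ->
    forall x y, L k x -> L k y -> lie x y = 0.
  move=> IH.
  (* Two passes: L_k commutes with L_(k+1) first, then with itself. *)
  have c1 z x : L k z -> L k.+1 x -> lie z x = 0.
    move=> Lz Lx; have Lu := Llie _ _ _ Lz (LW _ _ Lx).
    apply: mxtrace_conj_eq0 (Lso _ _ Lu) _.
    by rewrite mxtrace_lieA (IH _ _ Lx (LC _ _ Lu)) mulmx0 mxtrace0.
  move=> x y Lx Ly; have Lu := Llie _ _ _ Lx Ly.
  apply: mxtrace_conj_eq0 (Lso _ _ Lu) _.
  by rewrite mxtrace_lieA (c1 _ _ Ly (LC _ _ Lu)) mulmx0 mxtrace0.
have commute_down j : forall k, (k + j = K)%N -> forall x y, L k x -> L k y -> lie x y = 0.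
  elim: j => [|j IH] k.
    rewrite addn0 => -> x y [+ _] _; rewrite /derived hK memv0 => /eqP ->.
    by rewrite /lie mul0mx mulmx0 subrr.
  by rewrite addnS -addSn => /IH/step.
move=> x y xb xb' yb yb'.
exact: (commute_down K 0%N (add0n K) x y (conj xb xb') (conj yb yb')).
Qed.

Lemma conj_mx_grading a x :
  x \in grading_space xi a -> conj_mx x \in grading_space xi (- a).
Proof.
rewrite memv_cap => /andP[xs /mem_ad_eigenspace h]; rewrite memv_cap; apply/andP; split.
  exact: conj_mx_so.
apply/mem_ad_eigenspace; rewrite -/A -{1}conj_mx_complexify -conj_mx_lie h.
apply/matrixP => k l; rewrite !mxE rmorphM rmorphM /= conjCi rmorph_int.
by rewrite mulrNz mulrN mulNr.
Qed.

Definition weight_sums := undup [seq d kl.1 + d kl.2 | kl : 'I_n * 'I_n].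

Lemma mem_weight_sums k l : d k + d l \in weight_sums.
Proof. by rewrite mem_undup; apply/mapP; exists (k, l); rewrite // mem_enum. Qed.

Lemma sum_component x : \sum_(z <- weight_sums) component z x = x.
Proof.
apply: (can_inj coordsK); apply/matrixP => k l.
rewrite raddf_sum summxE; under eq_bigr => z _ do rewrite coords_component.
rewrite (bigD1_seq (d k + d l)) ?undup_uniq ?mem_weight_sums //=.
by rewrite eqxx big1 ?addr0 // => z /negPf zn; rewrite eq_sym zn.
Qed.

(* Take b maximal among the solvable subalgebras of q containing xi and
   \sum_(j >= 1) g_j.  A solvable b' above b is graded; if y in b' has degree a < 0, its
   conjugate y' has degree - a > 0, hence lies in b', so [y, y'] = 0 and
   i a tr (y y') = tr (xi [y, y']) = 0 gives y = 0.  Thus b' is contained in q. *)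
Lemma parabolic_filtered (q : {vspace 'M[R[i]]_n}) :
  (forall x, x \in q <-> filtered 0 x) ->
  (forall k l, k != l -> exists a : int, d k + d l = a%:~R) ->
  parabolic (so _ n) q.
Proof.
move=> hq hint.
have Aso : A \in so _ n by apply: complexify_so.
have lieAA : lie A A = 0 by rewrite /lie subrr.
have Aq : A \in q.
  apply/hq; split=> // k l c0; exists 0%N; split=> //.
  apply: (mulfI (neq0Ci _)); apply: (mulIf c0).
  rewrite mulr0 mul0r; have := coords_ad A k l; rewrite lieAA => <-.
  by rewrite raddf0 mxE.
have qso : (q <= so _ n)%VS by apply/subvP => x /hq[].
have qq : (lie_space q q <= q)%VS.
  by apply/lie_spaceP => x y /hq hx /hq hy; apply/hq/(lie_filtered hx hy).
have [V1 hV1] := filtered_space 1.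
pose b0 := (<[A]> + V1)%VS.
have b0V1 : (lie_space b0 b0 <= V1)%VS.
  apply/lie_spaceP => x y /memv_addP[_ /vlineP[a ->] [v /hV1 hv ->]].
  move=> /memv_addP[_ /vlineP[c ->] [w /hV1 hw ->]].
  have A0 : filtered 0 A by apply/hq.
  rewrite lie_linearl !lie_linearr lieAA scaler0 add0r; apply/hV1.
  have h2 : filtered 1 (lie A w) := lie_filtered A0 hw.
  have h3 : filtered 1 (lie v w) := filteredW (isT : 1 <= 2)%N (lie_filtered hv hw).
  have h4 : filtered 1 (lie v A) := lie_filtered hv A0.
  exact: filteredD (filteredZ a h2) (filteredD (filteredZ c h4) h3).
have V1b0 : (V1 <= b0)%VS by apply: addvSr.
pose Pr b := [/\ (b <= q)%VS, (lie_space b b <= b)%VS & lie_solvable b].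
have [b [[bq bb bs] b0b bmax]] : exists b, [/\ Pr b, (b0 <= b)%VS &
    forall b', Pr b' -> (b <= b')%VS -> b' = b].
  apply: exists_maximal_subv; split.
  - rewrite subv_add -memvE Aq; apply/subvP => x /hV1 h.
    by apply/hq/(filteredW _ h).
  - exact: subv_trans V1b0.
  (* For k >= 1 the k-th derived algebra of [b0] has degrees at least k, so it vanishes beyond the
     bound [N]. *)
  - have [N hN] := weight_bound; exists N.+1.
    have hk k x : x \in derived b0 k.+1 -> filtered k.+1 x.
      elim: k x => [|k IH] x.
        by rewrite derivedS => /(subvP b0V1)/hV1.
      have [V hV] := filtered_space k.+2.
      rewrite derivedS => h; apply/hV; apply: subvP h.
      apply/lie_spaceP => u v /IH hu /IH hv; apply/hV.
      apply: filteredW (lie_filtered hu hv); first by rewrite addSn ltnS leq_addl.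
    apply/eqP; rewrite -subv0; apply/subvP => x /hk[_ hx]; rewrite memv0; apply/eqP.
    apply: (can_inj coordsK); rewrite raddf0; apply/matrixP => k l; rewrite [RHS]mxE.
    apply/eqP; apply: contraT => /hx[m [Nm /hN]].
    by rewrite ltnNge (ltnW Nm).
split; first by split.
exists b; split=> //; split=> [||b' [b'so b'b'] b's bb'].
- by split=> //; apply: subv_trans qso.
- by [].
apply: bmax => //; split=> //; apply/subvP => y yb'; apply/hq.
have ys : y \in so _ n by apply: (subvP b'so).
split=> // k l c0.
have kl : k != l by apply: contraNneq c0 => ->; rewrite (coords_diag _ ys).
have [a e] := hint _ _ kl.
have [a0|a0] := leP 0 a.
  by exists `|a|%N; split=> //; rewrite e -[in LHS](gez0_abs a0).
set u := component a%:~R y.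
have Ab' : A \in b' by apply: (subvP bb'); apply: (subvP b0b); rewrite memvE addvSl.
have ub' : u \in b'.
  have iinj : injective (fun z : R[i] => 'i * z) by apply/mulfI/neq0Ci.
  apply: (stable_component (f := ad A) (c := component^~ y) (l := weight_sums)
            iinj (undup_uniq _)) => [x xb'|z||].
  - by rewrite adE; apply: (subvP b'b'); apply: memv_lie.
  - by rewrite adE ad_component.
  - by rewrite sum_component.
  - by rewrite -e mem_weight_sums.
have cub' : conj_mx u \in b'.
  apply: (subvP bb'); apply: (subvP b0b); apply: (subvP V1b0); apply/hV1.
  have /conj_mx_grading/grading_spaceP[cs h] := component_grading a ys.
  split; first exact: cs.
  move=> k' l' /h ->; exists `|a|%N; split; first by rewrite absz_gt0 (lt_eqF a0).
  by rewrite -[`|a|%N%:R]/((`|a|%N%:Z)%:~R) ltz0_abs.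
have lie0 : lie u (conj_mx u) = 0.
  by apply: (solvable_conj_commute b'so b'b' b's); rewrite ?conj_mxK.
have := mxtrace_lieA A u (conj_mx u).
rewrite lie0 mulmx0 mxtrace0 ad_component -scalemxAl mxtraceZ => /eqP.
rewrite !mulf_eq0 (negPf (neq0Ci _)) intr_eq0 (lt_eqF a0) /= => /eqP tr0.
have u0 := mxtrace_conj_eq0 (component_so _ ys) tr0.
have := coords_component a%:~R y k l; rewrite u0 e eqxx raddf0 mxE => y0.
by move: c0; rewrite -y0 eqxx.
Qed.

(** * Generation of the central descending series *)

Definition wedge (i j : 'I_n) := of_coords (delta_mx i j - delta_mx j i).

Lemma wedge_so i j : wedge i j \in so _ n.
Proof. by rewrite coords_so of_coordsK raddfB /= !trmx_delta opprB. Qed.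

Lemma wedgeN i j : wedge j i = - wedge i j.
Proof. by rewrite /wedge -opprB raddfN. Qed.

Lemma coords_wedge i j k l :
  coords (wedge i j) k l = ((k == i) && (l == j))%:R - ((k == j) && (l == i))%:R.
Proof. by rewrite of_coordsK !mxE. Qed.

Lemma wedge_entry i j : i != j -> coords (wedge i j) i j = 1.
Proof. by move=> ij; rewrite coords_wedge !eqxx (negPf ij) subr0. Qed.

Lemma wedge_weight i j k l : coords (wedge i j) k l != 0 -> d k + d l = d i + d j.
Proof.
rewrite coords_wedge; case: andP => [[/eqP -> /eqP ->] //|_].
by case: andP => [[/eqP -> /eqP ->]|_]; rewrite ?subrr ?eqxx // [RHS]addrC.
Qed.

Lemma wedge_filtered r (m : nat) i j :
  (r <= m)%N -> d i + d j = m%:R -> filtered r (wedge i j).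
Proof.
move=> rm e; split; first exact: wedge_so.
by move=> k l /wedge_weight ->; exists m.
Qed.

Lemma sum_wedge x : x \in so _ n ->
  x = \sum_i \sum_j (2^-1 * coords x i j) *: wedge i j.
Proof.
move=> xs; have nz2 : (2 : R[i]) != 0 by rewrite pnatr_eq0.
pose X := coords x; apply: (can_inj coordsK).
transitivity (\sum_i \sum_j (2^-1 * X i j) *: (delta_mx i j - delta_mx j i)); last first.
  rewrite raddf_sum; apply: eq_bigr => i _; rewrite raddf_sum; apply: eq_bigr => j _.
  by apply/matrixP => k l; rewrite coordsZ [LHS]mxE of_coordsK.
have hE : \sum_i \sum_j X i j *: delta_mx j i = X^T.
  rewrite exchange_big [RHS]matrix_sum_delta; apply: eq_bigr => i _.
  by apply: eq_bigr => j _; rewrite [X^T _ _]mxE.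
have hX : X^T = - X by move: xs; rewrite coords_so => /eqP.
transitivity (2^-1 *: (X - X^T)).
  by rewrite hX opprK -(mulr2n X) -(scaler_nat 2 X) scalerA mulVf // scale1r.
rewrite -hE {1}(matrix_sum_delta X) -sumrB scaler_sumr; apply: eq_bigr => i _.
rewrite -sumrB scaler_sumr; apply: eq_bigr => j _.
by rewrite -scalerBr scalerA.
Qed.

(* e_i /\ e_l^*, where e_l^* = cogram e_l is dual to e_l for the Gram matrix. *)
Definition raise (i l : 'I_n) := of_coords (delta_mx i l *m cogram - cogram *m delta_mx l i).

Lemma raise_filtered i l : d l = d i - 1 -> filtered 1 (raise i l).
Proof.
move=> dl; split.
  rewrite coords_so of_coordsK raddfB /= (trmx_mul (delta_mx i l)) (trmx_mul cogram).
  by rewrite cogramC !trmx_delta opprB.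
move=> p q; rewrite of_coordsK [X in X != 0]mxE [X in _ + X]mxE.
rewrite delta_mul_entry mul_delta_entry => h; exists 1%N; split=> //.
have key p' q' : (p' == i)%:R * cogram l q' != 0 -> d p' + d q' = 1.
  rewrite mulf_eq0 negb_or; have [->|] := eqVneq p' i; last by rewrite eqxx.
  rewrite oner_eq0 /= => /cogram_weight; rewrite dl => /eqP; rewrite addrC addr_eq0 => /eqP ->.
  by rewrite opprB addrC subrK.
have [h0|/key//] := eqVneq ((p == i)%:R * cogram l q) 0.
move: h; rewrite h0 add0r oppr_eq0 mulrC => h; rewrite addrC; apply: key.
by rewrite -{1}cogramC [X in _ * X]mxE.
Qed.

Lemma lie_raise_wedge i j l : l != j -> d i + d l != 0 -> d i + d j != 0 ->
  lie (raise i l) (wedge l j) = wedge i j.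
Proof.
move=> lj il ij; apply: (can_inj coordsK).
rewrite coords_lie /raise /wedge 3!of_coordsK.
have g0 k : d i + d k != 0 -> gram i k = 0.
  by move=> ik; apply/eqP; apply: contraNT ik => /gram_weight ->.
exact: (raise_bracket gramC cogramC gramK (g0 _ il) (g0 _ ij) lj).
Qed.

Lemma central_filtered (V : {vspace 'M[R[i]]_n}) :
  (forall x, x \in V -> filtered 1 x) ->
  forall r x, x \in central_descending V r.+1 -> filtered r.+1 x.
Proof.
move=> hV; elim=> [|r IH] x; first exact: hV.
have [W hW] := filtered_space r.+2.
move=> h; apply/hW; apply: subvP h; apply/lie_spaceP => u v /hV hu /IH hv.
by apply/hW; apply: (lie_filtered hu hv).
Qed.

(** Induction on r: a wedge of degree m >= r + 2 is the bracket of a [raise] element of degree 1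
    with a wedge of degree m - 1. The alternatives lower one index or the other, and antisymmetry
    exchanges them. *)
Lemma filtered_central (V : {vspace 'M[R[i]]_n}) :
  (forall x, filtered 1 x -> x \in V) ->
  (forall i j (r : nat), i != j -> d i + d j = r.+2%:R ->
     (exists l, [/\ l != j, d l = d i - 1 & d i + d l != 0]) \/
     (exists l, [/\ l != i, d l = d j - 1 & d j + d l != 0])) ->
  forall r x, filtered r.+1 x -> x \in central_descending V r.+1.
Proof.
move=> hV hgen; elim=> [|r IH] x; first exact: hV.
move=> [xs hx]; rewrite (sum_wedge xs); apply: rpred_sum => i _.
apply: rpred_sum => j _; have [->|c0] := eqVneq (coords x i j) 0.
  by rewrite mulr0 scale0r mem0v.
apply: rpredZ.
have ij : i != j by apply: contraNneq c0 => ->; rewrite (coords_diag _ xs).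
have [m [rm e]] := hx _ _ c0.
have em : m = m.-2.+2 by case: (m) rm => [|[]].
have e0 : d i + d j != 0 by rewrite e em pnatr_eq0.
have key i' j' l : d i' + d j' = m%:R -> l != j' -> d l = d i' - 1 -> d i' + d l != 0 ->
    wedge i' j' \in central_descending V r.+2.
  move=> e' lj dl il; rewrite -(lie_raise_wedge lj il) ?e' -?e //.
  apply: memv_lie; first by apply/hV/raise_filtered.
  apply: IH; apply: (@wedge_filtered _ m.-1); first by rewrite em; move: rm; rewrite em.
  by rewrite dl addrAC e' em /= -[in LHS]natr1 addrK.
rewrite em in e; case: (hgen _ _ _ ij e) => -[l [l1 l2 l3]].
  by apply: (key i j l) => //; rewrite em.
rewrite wedgeN rpredN; apply: (key j i l) => //; by rewrite addrC em.
Qed.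

(** The two factors contribute degrees at least r and s with total exactly r + s, so both are
    minimal. Skew matrices have zero diagonal, whence [p != i] and [q != j]. *)
Lemma lie_entry_weights r s x y i j : filtered r x -> filtered s y ->
  coords (lie x y) i j != 0 -> d i + d j = (r + s)%:R ->
  exists p q, [/\ d p + d q = 0, p != i, q != j &
    (d i + d p = r%:R /\ d q + d j = s%:R) \/
    (d i + d p = s%:R /\ d q + d j = r%:R)].
Proof.
have key r' s' x' y' : filtered r' x' -> filtered s' y' ->
    (coords x' *m gram *m coords y') i j != 0 -> d i + d j = (r' + s')%:R ->
    exists p q, [/\ d p + d q = 0, p != i, q != j &
      d i + d p = r'%:R /\ d q + d j = s'%:R].
  move=> [xs hx] [ys hy] /triple_entry[p [q [xp pq yq]]] e.
  have [m1 [l1 e1]] := hx _ _ xp; have [m2 [l2 e2]] := hy _ _ yq.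
  have : (m1 + m2)%:R = (r' + s')%:R :> R[i].
    rewrite -e natrD -e1 -e2 -[RHS]addr0 -pq; ring.
  move/eqP; rewrite eqr_nat => /eqP em.
  have [? ?] : m1 = r' /\ m2 = s' by lia.
  subst m1 m2; exists p, q; split=> //.
    by apply: contraNneq xp => ->; rewrite (coords_diag _ xs).
  by apply: contraNneq yq => ->; rewrite (coords_diag _ ys).
move=> hx hy; rewrite coords_lie [X in X != 0]mxE [X in _ + X]mxE.
have [->|n0 _] := eqVneq ((coords x *m gram *m coords y) i j) 0.
  rewrite sub0r oppr_eq0 => h; rewrite addnC => /(key _ _ _ _ hy hx h).
  by case=> p [q [h1 h2 h3 h4]]; exists p, q; split=> //; right.
by case/(key _ _ _ _ hx hy n0) => p [q [h1 h2 h3 h4]]; exists p, q; split=> //; left.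
Qed.

(** The (i, j) coordinate is a linear form with value 1 on [wedge i j]; if it vanished on all
    brackets, it would vanish on their span. *)
Lemma lie_space_entry (V W : {vspace 'M[R[i]]_n}) i j : i != j ->
  wedge i j \in lie_space V W ->
  exists x y, [/\ x \in V, y \in W & coords (lie x y) i j != 0].
Proof.
move=> ij h; apply: contrapT => ne.
pose f0 (x : 'M[R[i]]_n) : R[i]^o := coords x i j.
have fL : linear f0 by move=> a x y; rewrite /f0 coordsD coordsZ.
pose fm := GRing.isLinear.Build R[i] 'M[R[i]]_n R[i]^o *:%R f0 fL.
pose f : {linear 'M[R[i]]_n -> R[i]^o} := HB.pack f0 fm.
have : (lie_space V W <= lker (linfun f))%VS.
  apply/lie_spaceP => x y xV yW; rewrite memv_ker (lfunE f) /= /f0.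
  by apply: contraT => h0; case: ne; exists x, y; split.
move/subvP/(_ _ h); rewrite memv_ker (lfunE f) /= /f0 wedge_entry //.
by rewrite oner_eq0.
Qed.

(** * Spectra of [ad xi] and of xi in terms of weights *)

Lemma ad_spectrumP :
  (forall z : R[i],
    (so R[i] n :&: passmx.leigenspace (ad A) z != 0)%VS ->
    exists a : int, z = 'i * a%:~R) <->
  (forall k l, k != l -> exists a : int, d k + d l = a%:~R).
Proof.
have i0 : ('i : R[i]) != 0 := neq0Ci _.
split=> [h k l kl|h z].
  have wE : wedge k l \in (so R[i] n :&: passmx.leigenspace (ad A) ('i * (d k + d l)))%VS.
    by apply/ad_eigenP; split; [exact: wedge_so | move=> p q /wedge_weight].
  have [|a ea] := h ('i * (d k + d l)); last by exists a; apply: (mulfI i0).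
  apply: contraTneq wE => ->; rewrite memv0; apply/eqP => w0.
  by move: (wedge_entry kl); rewrite w0 raddf0 mxE => /eqP; rewrite eq_sym oner_eq0.
rewrite -{1}[z](mulVKf i0) => V0.
have /ad_eigenP[xs hx] := memv_pick
  (so R[i] n :&: passmx.leigenspace (ad A) ('i * ('i^-1 * z)))%VS.
move: xs hx; set x := vpick _ => xs hx.
have : coords x != 0.
  by rewrite -(raddf0 coords) (can_eq coordsK) vpick0.
case/matrix0Pn => k [l c0].
have kl : k != l by apply: contraNneq c0 => ->; rewrite (coords_diag _ xs).
have [a ea] := h _ _ kl; exists a.
by rewrite -ea (hx _ _ c0) mulVKf.
Qed.

Lemma eigenvectorE (v : 'rV[R[i]]_n) z : v *m A = z *: v ->
  forall k, (v *m Q) 0 k != 0 -> z = 'i * d k.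
Proof.
move=> h k v0; apply: (mulIf v0).
have : v *m Q *m D = z *: (v *m Q).
  by rewrite scalemxAl -h AE -!mulmxA PQ mulmx1.
move: (v *m Q) => u /matrixP/(_ 0 k); rewrite mul_mx_diag !mxE => <-.
by rewrite mulrC.
Qed.

Lemma row_eigenvector k : row k P *m A = ('i * d k) *: row k P.
Proof.
rewrite -row_mul AE !mulmxA PQ mul1mx mul_diag_mx.
by apply/rowP => l; rewrite !mxE.
Qed.

Lemma eigenvalue_complexifyE z : eigenvalue A z <-> exists k, z = 'i * d k.
Proof.
split=> [/eigenvalueP[v vA v0]|[k ->]].
  have : v *m Q != 0.
    by apply: contra_neq v0 => vQ0; rewrite -[v]mulmx1 -QP mulmxA vQ0 mul0mx.
  by case/rV0Pn => k /(eigenvectorE vA) ->; exists k.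
apply/eigenvalueP; exists (row k P); first exact: row_eigenvector.
apply/eqP => r0; have := row1 R[i] k; rewrite -PQ row_mul r0 mul0mx.
by move/rowP/(_ k)/eqP; rewrite !mxE !eqxx eq_sym oner_eq0.
Qed.

(** The rows of P form an eigenbasis. If no index besides [k] had eigenvalue z, the eigenspace would
    lie in the line of row k; using this twice gives two indices. Conversely, distinct rows are
    independent. *)
Lemma rank_eigenspace_ge2P z : (2 <= \rank (eigenspace A z))%N <->
  exists k l, [/\ k != l, z = 'i * d k & z = 'i * d l].
Proof.
split=> [h|[k [l [kl zk zl]]]].
  have other k : exists2 l, l != k & z = 'i * d l.
    case: (boolP [exists l, (l != k) && (z == 'i * d l)]) => [/existsP[l /andP[lk /eqP e]]|].
      by exists l.
    move/existsPn => no; suff : (\rank (eigenspace A z) <= 1)%N by rewrite leqNgt h.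
    apply: leq_trans (rank_leq_row (row k P)); apply: mxrankS; apply/row_subP => r.
    have vA : row r (eigenspace A z) *m A = z *: row r (eigenspace A z).
      by apply/eigenspaceP/row_sub.
    move: (row r _) vA => v vA.
    suff -> : v = (v *m Q) 0 k *: row k P by apply: scalemx_sub.
    rewrite -{1}[v]mulmx1 -QP mulmxA mulmx_sum_row (bigD1 k) //= big1 ?addr0 // => l lk.
    have [->|/(eigenvectorE vA) e] := eqVneq ((v *m Q) 0 l) 0; first by rewrite scale0r.
    by have := no l; rewrite lk e eqxx.
  have n0 : (0 < n)%N by apply: leq_trans (leq_trans h (rank_leq_row _)).
  have [l _ zl] := other (Ordinal n0); have [m ml zm] := other l.
  by exists m, l.
pose f (a : 'I_2) := if a == 0 then k else l.
have finj : injective f.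
  move=> a b; rewrite /f; have [->|a0] := eqVneq a 0; have [->|b0] := eqVneq b 0 => //.
  - by move/eqP; rewrite (negPf kl).
  - by move/esym/eqP; rewrite (negPf kl).
  - by move=> _; apply/val_inj; case: a a0 => [[|[|//]] //= ?]; case: b b0 => [[|[|//]] //= ?].
have fr : row_free (rowsub f P).
  apply/row_freeP; exists (colsub f Q); apply/matrixP => a b.
  have /matrixP/(_ (f a) (f b)) := PQ; rewrite !mxE (inj_eq finj) => <-.
  by apply: eq_bigr => m _; rewrite !mxE.
rewrite -(eqP fr); apply: mxrankS; apply/row_subP => a; rewrite row_rowsub.
apply/eigenspaceP; rewrite row_eigenvector; congr (_ *: _).
by rewrite /f; case: ifP.
Qed.

(** * Symmetry and half-integrality of the weights *)

(** [gram] is invertible, so some permutation contributes a nonzero term to its determinant, and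
    nonzero entries of [gram] join opposite weights. *)
Lemma weight_involution :
  exists2 s : 'I_n -> 'I_n, injective s & forall k, d (s k) = - d k.
Proof.
have det0 : \det gram != 0.
  have := congr1 determinant gramK; rewrite det_mulmx det1 => h.
  by apply: contraTneq (oner_neq0 R[i]) => g0; rewrite -h g0 mul0r eqxx.
have [s hs] : exists s : {perm 'I_n}, \prod_k gram k (s k) != 0.
  apply: contrapT => no; case/eqP: det0; rewrite /determinant big1 // => s _.
  apply/eqP; apply: contraT; rewrite mulf_eq0 negb_or => /andP[_ h].
  by case: no; exists s.
exists s; first exact: perm_inj.
move=> k; apply/eqP; rewrite -addr_eq0 addrC; apply/eqP/gram_weight.
by move/prodf_neq0: hs; apply.
Qed.

(** Since n >= 3, some [m] differs from [k] and [s k]; then 2 d k is the sum of d k + d m and d k +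
    d (s m), or, if [s m = k], the opposite of d m + d (s k). Differences are d k + d (s l). *)
Lemma half_integral_weights : (3 <= n)%N ->
  (forall k l, k != l -> exists a : int, d k + d l = a%:~R) ->
  exists w : 'I_n -> int, (forall k, (w k)%:~R = 2 * d k) /\
    forall k l, exists c : int, w k - w l = 2 * c.
Proof.
move=> n3 hint; have [s s_inj sN] := weight_involution.
have dbl k : exists a : int, 2 * d k = a%:~R.
  have /subsetPn[m _ hm] : ~~ ([set: 'I_n] \subset [set k; s k]).
    apply/negP => /subset_leq_card; rewrite cardsT card_ord cards2.
    by case: (_ != _) n3; lia.
  move: hm; rewrite !inE negb_or => /andP[mk msk].
  have [e|ne] := eqVneq (s m) k.
    have [a ea] := hint _ _ msk; exists (- a).
    by rewrite rmorphN /= -ea sN -e sN; ring.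
  have [a ea] := hint _ _ mk; have [b eb] := hint _ _ ne; exists (a + b).
  by rewrite rmorphD /= -ea -eb sN; ring.
have diff k l : exists c : int, d k - d l = c%:~R.
  have [<-|kl] := eqVneq (s l) k.
    have [a ea] := dbl l; exists (- a).
    by rewrite rmorphN /= -ea sN; ring.
  by have [a ea] := hint _ _ kl; exists a; rewrite -ea sN addrC.
have /fin_all_exists[w hw] := dbl; exists w; split=> [k|k l]; first by rewrite hw.
have [c ec] := diff k l; exists c.
by apply/eqP; rewrite -(eqr_int R[i]) rmorphB rmorphM /= -!hw -ec; apply/eqP; ring.
Qed.

(** * Canonicity as a condition on the weights *)

(** The wedge of [i] and [j] has some degree r + 2, so it lies in [n, n^(r+1)]; hence some bracket
    has a nonzero (i, j) entry, whose intermediate weights are read off. *)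
Lemma canonical_generated (q : {vspace 'M[R[i]]_n}) (w : 'I_n -> int) :
  canonical_element q xi -> (forall k, (w k)%:~R = 2 * d k) ->
  forall i j, i != j -> 4 <= w i + w j ->
  exists p q, [/\ w p = - w q, p != i, q != j & w i + w p = 2 \/ w q + w j = 2].
Proof.
move=> [_ /ad_spectrumP hint _ hr] hw i j ij h4.
have hV r x : x \in central_descending (polar (so _ n) q) r.+1 <-> filtered r.+1 x.
  by split=> [/hr/in_filtrationE|/in_filtrationE/hr]; apply.
have nz2 : (2 : R[i]) != 0 by rewrite pnatr_eq0.
have w_eq (a : int) k l : d k + d l = a%:~R -> w k + w l = 2 * a.
  move=> e; apply/eqP; rewrite -(eqr_int R[i]) rmorphD rmorphM /= !hw -e.
  by rewrite -mulrDr.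
have [a ea] := hint _ _ ij; have wa := w_eq _ _ _ ea.
have [r er] : exists r : nat, a = r.+2%:Z by exists `|a - 2|%N; lia.
have e : d i + d j = (1 + r.+1)%:R by rewrite ea er.
have := wedge_filtered (leqnn r.+2) e; move/hV.
case/(lie_space_entry ij) => x [y [/(hV 0%N) hx /(hV r) hy h]].
have [p [q' [pq pi qj h']]] := lie_entry_weights hx hy h e.
exists p, q'; split=> //; first by have := w_eq 0 _ _ pq; lia.
case: h' => -[h1 h2]; first by left; have := w_eq 1 _ _ h1; lia.
by right; have := w_eq 1 _ _ h2; lia.
Qed.

(** With [q] the part of degree >= 0, everything reduces to generation in degrees >= 2, which
    [ladder_step] supplies. *)
Lemma canonical_of_weights (w : 'I_n -> int) : (3 <= n)%N ->
  (forall k, (w k)%:~R = 2 * d k) ->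
  (forall k l, exists c : int, w k - w l = 2 * c) ->
  (forall k, 2 <= w k -> exists l, w l = w k - 2) ->
  (forall k, w k = 1 -> exists2 l, l != k & w l = 1) ->
  canonical xi.
Proof.
move=> n3 hw parity down dbl.
have [s s_inj sN] := weight_involution.
have nz2 : (2 : R[i]) != 0 by rewrite pnatr_eq0.
have w_eq (a : int) k l : (w k + w l = 2 * a) <-> d k + d l = a%:~R.
  split=> e; [apply: (mulfI nz2); rewrite mulrDr -!hw | apply/eqP].
    by rewrite -rmorphD /= e rmorphM.
  by rewrite -(eqr_int R[i]) rmorphD rmorphM /= !hw -e -mulrDr.
(* The sum d k + d l is the difference d k - d (s l), hence integral by parity. *)
have hint k l : k != l -> exists a : int, d k + d l = a%:~R.
  move=> _; have [c ec] := parity k (s l); exists c; apply/w_eq; rewrite -ec.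
  congr (_ + _); apply/eqP; rewrite -(eqr_int R[i]) rmorphN /= !hw sN.
  by rewrite mulrN opprK.
have [q hq] := filtered_space 0.
have hpol := polar_filtered n3 hq hint.
exists q; split; first exact: parabolic_filtered.
split=> //; first by apply/ad_spectrumP.
  by move=> x; rewrite hq in_filtrationE.
move=> [//|r] x _; rewrite in_filtrationE; split.
  by apply: central_filtered => y /hpol.
apply: filtered_central => [y /hpol //|i j {}r ij e].
have e' : w i + w j = 2 * r.+2%:Z by apply/w_eq.
have h4 : 4 <= w i + w j by rewrite e'; lia.
have w0 k l : w k + w l != 0 -> d k + d l != 0.
  by apply: contra_neq => /(w_eq 0); rewrite mulr0.
have w1 k l : w l = w k - 2 -> d l = d k - 1.
  move=> h; apply: (mulfI nz2); rewrite mulrBr -!hw h rmorphB /=; ring.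
case: (ladder_step down dbl ij h4) => -[l [h1 h2 h3]]; [left|right];
  exists l; split; [done|exact: w1|exact: w0|done|exact: w1|exact: w0].
Qed.

Lemma eigenvalue_weights (w : 'I_n -> int) z :
  (forall k, (w k)%:~R = 2 * d k) ->
  eigenvalue A z <-> exists k, z = 'i * ((w k)%:~R / 2).
Proof.
move=> hw; rewrite eigenvalue_complexifyE.
have h k : (w k)%:~R / 2 = d k by rewrite hw mulrC mulKf // pnatr_eq0.
by split=> -[k ->]; exists k; rewrite h.
Qed.

End Weights.

(** * From weights to eigenvalues of xi *)

(** Being real and skew, A has adjoint - A, so it is normal and the spectral theorem applies. *)
Lemma skew_diagonalization (R : realType) (n : nat) (xi : 'M[R]_n) : xi \in so R n ->
  exists (P Q : 'M[R[i]]_n) (d : 'I_n -> R[i]), P *m Q = 1%:M /\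
    complexify xi = Q *m diag_mx (\row_k ('i * d k)) *m P.
Proof.
move=> hxi; set A := complexify xi.
have AT : A^T = - A by apply/eqP; rewrite -memv_so; apply: complexify_so.
have Ac : map_mx Num.conj A = A.
  by apply/matrixP => k l; rewrite !mxE; apply: conjc_real.
have An : A \is normalmx.
  by apply/normalmxP; rewrite AT map_mxN Ac mulmxN mulNmx.
have AE := orthomx_spectralP An.
have Pu := spectral_unit A.
exists (spectralmx A), (invmx (spectralmx A)), (fun k => spectral_diag A 0 k / 'i).
split; first exact: mulmxV.
rewrite [LHS]AE; congr (_ *m diag_mx _ *m _); apply/rowP => k.
by rewrite mxE mulrCA mulfV ?mulr1 // neq0Ci.
Qed.

Theorem proposition4p1 (R : realType) (n : nat) (hn : (3 <= n)%N)
    (xi : 'M[R]_n) (hxi : xi \in so R n) :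
  canonical xi <->
  (exists k : nat, forall z : R[i],
     eigenvalue (complexify xi) z <->
     exists j : nat, (j <= k)%N /\ (z = 'i * j%:R \/ z = - ('i * j%:R)))
  \/
  (exists k : nat,
     (forall z : R[i],
        eigenvalue (complexify xi) z <->
        exists j : nat, (j <= k)%N /\
          (z = 'i * (j%:R + 2^-1) \/ z = - ('i * (j%:R + 2^-1))))
     /\ (2 <= \rank (eigenspace (complexify xi) ('i * 2^-1)))%N
     /\ (2 <= \rank (eigenspace (complexify xi) (- ('i * 2^-1))))%N).
Proof.
have [P [Q [d [PQ AE]]]] := skew_diagonalization hxi.
have [s s_inj sN] := weight_involution hxi PQ AE.
have i0 : ('i : R[i]) != 0 := neq0Ci _.
have nz2 : (2 : R[i]) != 0 by rewrite pnatr_eq0.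
(* The eigenvalue whose doubled weight is [a]: the two cases are a = 2 j and a = 2 j + 1, up to
   sign. *)
pose e (a : int) : R[i] := 'i * (a%:~R / 2).
have e_inj : injective e.
  move=> a b /(mulfI i0)/(mulIf (_ : 2^-1 != 0)) h; apply/eqP.
  by rewrite -(eqr_int R[i]); apply/eqP/h; rewrite invr_eq0.
have e_even (j : nat) : 'i * j%:R = e (j%:Z * 2).
  by rewrite /e rmorphM /= mulfK.
have e_odd (j : nat) : 'i * (j%:R + 2^-1) = e (j%:Z * 2 + 1).
  by rewrite /e rmorphD rmorphM /= mulrDl mulfK // mul1r.
have eN a : - e a = e (- a) by rewrite /e rmorphN /= mulNr mulrN.
have e1 : 'i * 2^-1 = e 1 by rewrite /e mul1r.
(* Both cases at once: [g j] lists eigenvalues and [f j] the matching doubled weights. *)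
have spec (w : 'I_n -> int) (f : nat -> int) (g : nat -> R[i]) (k : nat) :
    (forall l, (w l)%:~R = 2 * d l) -> (forall j, g j = e (f j)) ->
    (forall z, eigenvalue (complexify xi) z <->
       exists j : nat, (j <= k)%N /\ (z = g j \/ z = - g j)) <->
    (forall a, (exists l, w l = a) <->
       exists j : nat, (j <= k)%N /\ (a = f j \/ a = - f j)).
  move=> hw gE; have ev z := eigenvalue_weights PQ AE z hw.
  have zE z a : z = e a -> forall j, (z = g j \/ z = - g j) <-> (a = f j \/ a = - f j).
    by move=> -> j; rewrite gE eN; split=> -[]; [move/e_inj; left | move/e_inj; right
      | move=> ->; left | move=> ->; right].
  split=> h.
    move=> a; split=> [[l wl]|[j [jk /(zE _ _ erefl) hj]]].
      have /ev/h[j [jk /(zE _ _ erefl) hj]] : exists l, e a = e (w l) by exists l; rewrite wl.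
      by exists j.
    have /h/ev[l /e_inj ->] : exists j, (j <= k)%N /\ (e a = g j \/ e a = - g j) by exists j.
    by exists l.
  move=> z; rewrite ev; split=> [[l zl]|[j [jk hj]]].
    have /h[j [jk hj]] : exists l', w l' = w l by exists l.
    by exists j; split=> //; apply/(zE _ _ zl).
  have [a za] : exists a, z = e a.
    by case: hj => ->; rewrite gE ?eN; [exists (f j) | exists (- f j)].
  have /h[l wl] : exists j, (j <= k)%N /\ (a = f j \/ a = - f j).
    by exists j; split=> //; apply/(zE _ _ za).
  by exists l; rewrite za wl.
have rank2 (w : 'I_n -> int) a : (forall l, (w l)%:~R = 2 * d l) ->
    (2 <= \rank (eigenspace (complexify xi) (e a)))%N <->
    exists k l, [/\ k != l, w k = a & w l = a].
  move=> hw; rewrite (rank_eigenspace_ge2P PQ AE).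
  have we k : 'i * d k = e (w k) by rewrite /e hw [2 * _]mulrC mulfK.
  split=> -[k [l [kl hk hl]]]; exists k, l; split=> //; move: hk hl; rewrite ?we.
  - by move=> /e_inj.
  - by move=> _ /e_inj.
  - by move=> ->.
  - by move=> _ ->.
split=> [[q [_ can]]|].
  have [_ /(ad_spectrumP hxi PQ AE) hint _ _] := can.
  have [w [hw parity]] := half_integral_weights hxi PQ AE hn hint.
  have wN k : w (s k) = - w k.
    by apply/eqP; rewrite -(eqr_int R[i]) rmorphN /= !hw sN mulrN.
  have gen := canonical_generated hxi PQ AE can hw.
  case: (weight_classification parity s_inj wN hn gen) => [[k hk]|[k [hk two]]].
    by left; exists k; apply/(spec w _ _ _ hw e_even).
  right; exists k; rewrite e1 eN; split; first by apply/(spec w _ _ _ hw e_odd).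
  split; apply/(rank2 w) => //.
  (* [s] carries two indices of doubled weight 1 to two of doubled weight - 1. *)
  have [i [j [ij wi wj]]] := two; exists (s i), (s j).
  by rewrite (inj_eq s_inj) !wN wi wj.
(* Conversely, either description of the spectrum makes every [2 * d l] an integer. *)
have weights (f : nat -> int) (g : nat -> R[i]) (k : nat) :
    (forall j, g j = e (f j)) ->
    (forall z, eigenvalue (complexify xi) z <->
       exists j : nat, (j <= k)%N /\ (z = g j \/ z = - g j)) ->
    exists2 w : 'I_n -> int, (forall l, (w l)%:~R = 2 * d l) &
      forall a, (exists l, w l = a) <->
         exists j : nat, (j <= k)%N /\ (a = f j \/ a = - f j).
  move=> gE h.
  have /fin_all_exists[w hw] l : exists a : int, a%:~R = 2 * d l.
    have /h[j [_ hj]] : eigenvalue (complexify xi) ('i * d l).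
      by apply/(eigenvalue_complexifyE PQ AE); exists l.
    have [a ha] : exists a, 'i * d l = e a.
      by case: hj => ->; rewrite gE ?eN; [exists (f j) | exists (- f j)].
    by exists a; move: ha => /(mulfI i0) ->; rewrite mulrC divfK.
  by exists w => //; apply/(spec w f g k hw gE).
case=> [[k h]|[k [h [r1 _]]]].
  have [w hw hk] := weights _ _ _ e_even h.
  have val l : exists j : nat, (j <= k)%N /\ (w l = j%:Z * 2 \/ w l = - (j%:Z * 2)).
    by apply/hk; exists l.
  apply: (canonical_of_weights hxi PQ AE hn hw) => [l m|l wl|l wl].
  - by have [j [_ hj]] := val l; have [j' [_ hj']] := val m; case: hj hj' => -> [] ->;
      [exists (j%:Z - j'%:Z)|exists (j%:Z + j'%:Z)
      |exists (- j%:Z - j'%:Z)|exists (- j%:Z + j'%:Z)]; lia.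
  - have [j [jk hj]] := val l.
    (* As [w l >= 2], the sign is positive and j >= 1, so j - 1 is still in range. *)
    have /hk[m hm] : exists j' : nat, (j' <= k)%N /\
        (w l - 2 = j'%:Z * 2 \/ w l - 2 = - (j'%:Z * 2)).
      by exists j.-1; split; [lia | left; lia].
    by exists m.
  (* All doubled weights are even here, so the value 1 does not occur. *)
  - by have [j [jk hj]] := val l; lia.
have [w hw hk] := weights _ _ _ e_odd h.
have val l : exists j : nat, (j <= k)%N /\ (w l = j%:Z * 2 + 1 \/ w l = - (j%:Z * 2 + 1)).
  by apply/hk; exists l.
apply: (canonical_of_weights hxi PQ AE hn hw) => [l m|l wl|l wl].
- by have [j [_ hj]] := val l; have [j' [_ hj']] := val m; case: hj hj' => -> [] ->;
    [exists (j%:Z - j'%:Z)|exists (j%:Z + j'%:Z + 1)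
    |exists (- j%:Z - j'%:Z - 1)|exists (- j%:Z + j'%:Z)]; lia.
- have [j [jk hj]] := val l.
  have /hk[m hm] : exists j' : nat, (j' <= k)%N /\
        (w l - 2 = j'%:Z * 2 + 1 \/ w l - 2 = - (j'%:Z * 2 + 1)).
    by exists j.-1; split; [lia | left; lia].
  by exists m.
(* The multiplicity of i / 2 yields two indices of doubled weight 1, one of which differs from
   [l]. *)
move: r1; rewrite e1 => /(rank2 w 1 hw)[i [j [ij wi wj]]].
by have [<-|il] := eqVneq i l; [exists j => //; rewrite eq_sym | exists i].
Qed.
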